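(* Let $R$ be a Noetherian commutative ring, let $S$ be a finitely generated commutative $R$-algebra, and let $F$ be a finitely generated $S$-module. Assume that $F$ is a flat $R$-module. Then $F$ is a very flat $R$-module.
   Context: For $r\in R$, $R[r^{-1}]$ denotes the localization at the powers of $r$. An $R$-module $C$ is $r$-contraadjusted if $\mathrm{Ext}^1_R(R[r^{-1}],C)=0$, and contraadjusted if it is $r$-contraadjusted for every $r\in R$. An $R$-module $F$ is very flat if $\mathrm{Ext}^1_R(F,C)=0$ for every contraadjusted $R$-module $C$. *)

(* Defs.v *)
From HB Require Import structures.
From mathcomp Require Import all_boot all_order all_algebra.
Set Implicit Arguments. Unset Strict Implicit. Unset Printing Implicit Defensive.
Import GRing.Theory.
Local Open Scope ring_scope.

Section Restr.
Variables (R S : pzRingType) (f : {rmorphism R -> S}) (M : lmodType S).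
Definition restr : Type := let _ := f in M.
HB.instance Definition _ := GRing.Zmodule.on restr.
Definition restr_scale (a : R) (x : restr) : restr := (f a *: (x : M) : M).
Fact restr_scalerA a b (v : restr) :
  restr_scale a (restr_scale b v) = restr_scale (a * b) v.
Proof. by rewrite /restr_scale scalerA rmorphM. Qed.
Fact restr_scale1r : left_id 1 restr_scale.
Proof. by move=> v; rewrite /restr_scale rmorph1 scale1r. Qed.
Fact restr_scalerDr : right_distributive restr_scale +%R.
Proof. by move=> a u v; rewrite /restr_scale scalerDr. Qed.
Fact restr_scalerDl (v : restr) : {morph restr_scale^~ v : a b / a + b}.
Proof. by move=> a b; rewrite /restr_scale rmorphD scalerDl. Qed.
HB.instance Definition _ := GRing.Zmodule_isLmodule.Build R restr
  restr_scalerA restr_scale1r restr_scalerDr restr_scalerDl.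
End Restr.
Arguments restr {R S} f M.

Definition is_ideal (R : comPzRingType) (I : R -> Prop) : Prop :=
  [/\ I 0, (forall x y, I x -> I y -> I (x + y)) & (forall a x, I x -> I (a * x))].

Definition ideal_fin_gen (R : comPzRingType) (I : R -> Prop) : Prop :=
  exists s : seq R, forall x,
    I x <-> exists c : 'I_(size s) -> R, x = \sum_(i < size s) c i * s`_i.

Definition noetherian (R : comPzRingType) : Prop :=
  forall I : R -> Prop, is_ideal I -> ideal_fin_gen I.

Definition fin_gen_algebra (R S : comPzRingType) (phi : {rmorphism R -> S}) : Prop :=
  exists (n : nat) (g : 'I_n -> S), forall x : S,
    exists s : seq (R * {ffun 'I_n -> nat}),
      x = \sum_(t <- s) phi t.1 * \prod_(i < n) g i ^+ t.2 i.

Definition fin_gen_module (S : pzRingType) (M : lmodType S) : Prop :=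
  exists s : seq M, forall x : M,
    exists c : 'I_(size s) -> S, x = \sum_(i < size s) c i *: s`_i.

Definition bilin (R : comPzRingType) (M N : lmodType R) (W : lmodType R)
  (b : M -> N -> W) : Prop :=
  (forall n, linear (b^~ n)) /\ (forall m, linear (b m)).

Definition is_tensor_product (R : comPzRingType) (M N T : lmodType R)
  (b : M -> N -> T) : Prop :=
  bilin b /\
  forall (W : lmodType R) (g : M -> N -> W), bilin g ->
    (exists h : {linear T -> W}, forall m n, h (b m n) = g m n) /\
    (forall h1 h2 : {linear T -> W},
       (forall m n, h1 (b m n) = g m n) -> (forall m n, h2 (b m n) = g m n) ->
       h1 =1 h2).

Definition flat (R : comPzRingType) (F : lmodType R) : Prop :=
  forall (N N' : lmodType R) (f : {linear N -> N'}), injective f ->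
  forall (T : lmodType R) (b : F -> N -> T) (T' : lmodType R) (b' : F -> N' -> T'),
    is_tensor_product b -> is_tensor_product b' ->
  forall g : {linear T -> T'}, (forall x n, g (b x n) = b' x (f n)) ->
    injective g.

(* Ext^1_R(M, C) = 0, with Ext^1 in its Yoneda description: every short exact
   sequence 0 -> C -> E -> M -> 0 of R-modules splits. *)
Definition ext1_zero (R : comPzRingType) (M C : lmodType R) : Prop :=
  forall (E : lmodType R) (i : {linear C -> E}) (p : {linear E -> M}),
    injective i -> (forall m, exists e, p e = m) ->
    (forall e, p e = 0 <-> exists c, e = i c) ->
    exists s : {linear M -> E}, forall m, p (s m) = m.

Definition is_localization (R : comPzRingType) (r : R)
  (A : comPzRingType) (psi : {rmorphism R -> A}) : Prop :=
  [/\ exists u : A, psi r * u = 1,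
      (forall a, psi a = 0 <-> exists k, r ^+ k * a = 0)
    & (forall x : A, exists a n, x * psi r ^+ n = psi a)].

Definition r_contraadjusted (R : comPzRingType) (r : R) (C : lmodType R) : Prop :=
  forall (A : comPzRingType) (psi : {rmorphism R -> A}),
    is_localization r psi -> ext1_zero (restr psi A^o) C.

Definition contraadjusted (R : comPzRingType) (C : lmodType R) : Prop :=
  forall r : R, r_contraadjusted r C.

Definition very_flat (R : comPzRingType) (F : lmodType R) : Prop :=
  forall C : lmodType R, contraadjusted C -> ext1_zero F C.

(* Main.v *)
From HB Require Import structures.
Require Import Defs.
From mathcomp Require Import all_boot all_order all_algebra.
From mathcomp Require Import boolp functions ring zify.
Set Implicit Arguments. Unset Strict Implicit. Unset Printing Implicit Defensive.
Import GRing.Theory.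
Local Open Scope quotient_scope.
Local Open Scope ring_scope.

(* Present F as L0/Om with L0 free of countable rank, so that Ext^1(F, C) = 0
   means that every map Om -> C extends to L0. By Noetherian induction on an
   ideal I, this holds for every contraadjusted C killed by I.

   Let r be outside I. Since C is contraadjusted, it is the image of a
   contraadjusted P, still killed by I, with bounded r-torsion: P is the module
   of germs at infinity of sequences in a free R/I-module L over C whose images
   in C are eventually constant. Flatness of F makes Om a union of finitely
   generated submodules on which the identity extends to a map L0 -> Om, so maps
   Om -> C lift to P. Now P is an extension of its r-adic completion by D, the
   intersection of the r^n P, on which r is bijective. The completion is handled by
   successive approximation through quotients of P killed by I + (r), so the
   induction hypothesis leaves only D.

   If I is not prime, take ab in I with a, b not in I, and r = a: then D is killed
   by I + (b). If I is prime, generic freeness provides r such that F/IF becomes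
   free over (R/I)[1/r], and then maps from Om to modules over (R/I)[1/r] extend.
   Generic freeness is proved by leading terms: r is the product of the leading
   coefficients of finitely many relations whose leading monomials generate, by
   Dickson's lemma, all leading monomials of relations modulo I. *)

(** * Submodules, quotients and free modules *)

Definition is_linear (R : pzRingType) (M N : lmodType R) (f : M -> N) : Prop :=
  forall a x y, f (a *: x + y) = a *: f x + f y.

Section LinearPack.
Variables (R : pzRingType) (M N : lmodType R) (f : M -> N).
Hypothesis f_lin : is_linear f.
(** The vacuous [let] makes the proof of linearity a parameter of [linear_pack], so that an instance
    of linear map can be attached to it. *)
Definition linear_pack : M -> N := let _ := f_lin in f.
Fact linear_pack_is_linear : linear linear_pack. Proof. exact: f_lin. Qed.
HB.instance Definition _ :=
  GRing.isLinear.Build R M N *:%R linear_pack linear_pack_is_linear.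
End LinearPack.

Lemma is_linear_bundle (R : pzRingType) (M N : lmodType R) (f : M -> N) :
  is_linear f -> exists g : {linear M -> N}, g =1 f.
Proof. by move=> fl; exists (linear_pack fl : {linear M -> N}). Qed.

Definition is_submodule (R : pzRingType) (M : lmodType R) (A : M -> Prop) : Prop :=
  A 0 /\ forall a x y, A x -> A y -> A (a *: x + y).

Section SubmoduleClosure.
Variables (R : pzRingType) (M : lmodType R) (A : M -> Prop).
Hypothesis subA : is_submodule A.

Lemma submod0 : A 0. Proof. by case: subA. Qed.

Lemma submodD x y : A x -> A y -> A (x + y).
Proof. by case: subA => _ h Ax Ay; rewrite -[x]scale1r; exact: h. Qed.

Lemma submodZ a x : A x -> A (a *: x).
Proof. by case: subA => A0 h Ax; rewrite -[_ *: _]addr0; exact: h. Qed.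

Lemma submodN x : A x -> A (- x).
Proof. by rewrite -scaleN1r; exact: submodZ. Qed.

Lemma submodB x y : A x -> A y -> A (x - y).
Proof. by move=> Ax Ay; apply: submodD => //; exact: submodN. Qed.

Lemma submod_sum (I : Type) (s : seq I) (P : pred I) (F : I -> M) :
  (forall i, P i -> A (F i)) -> A (\sum_(i <- s | P i) F i).
Proof.
by move=> AF; elim/big_ind: _ => //; [exact: submod0 | exact: submodD].
Qed.

End SubmoduleClosure.

Section SubquotientCarriers.
Variables (R : pzRingType) (M : lmodType R) (A : M -> Prop).
Hypothesis subA : is_submodule A.

Definition submod_pred : pred M := let _ := subA in fun x => `[< A x >].

Fact submod_pred_closed : subsemimod_closed submod_pred.
Proof.
split; first split.
- by apply/asboolP; exact: submod0.
- by move=> x y /asboolP Ax /asboolP Ay; apply/asboolP; exact: submodD.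
- by move=> a x /asboolP Ax; apply/asboolP; exact: submodZ.
Qed.
HB.instance Definition _ :=
  GRing.isSubmodClosed.Build R M submod_pred submod_pred_closed.

Definition submod_type : Type := {x : M | submod_pred x}.
HB.instance Definition _ := SubChoice.on submod_type.
HB.instance Definition _ := [SubChoice_isSubLmodule of submod_type by <:].

Lemma submodule_carrier : exists (U : lmodType R) (i : {linear U -> M}),
  injective i /\ forall x, A x <-> exists u, i u = x.
Proof.
exists (submod_type : lmodType R), (\val : {linear submod_type -> M}).
split=> [|x]; first exact: val_inj.
split=> [Ax|[u <-]]; last exact: asboolW (valP u).
by exists (exist _ x (asboolT Ax)).
Qed.

Definition quot_type : Type := Quotient.quot (GRing.ZmodClosed.clone M submod_pred _).
HB.instance Definition _ := GRing.Zmodule.on quot_type.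
HB.instance Definition _ := EqQuotient.on quot_type.
Local Notation qpi := (\pi_quot_type : M -> quot_type).

Definition quot_scale (a : R) (q : quot_type) : quot_type := \pi_quot_type (a *: repr q : M).

Lemma quot_piE (x y : M) :
  (qpi x = qpi y :> quot_type) <-> A (x - y).
Proof.
have := Quotient.idealrBE (GRing.ZmodClosed.clone M submod_pred _) x y.
move=> e; split=> [/eqP xy|Axy]; last by apply/eqP; rewrite -e; apply/asboolP.
by apply/asboolP; change (is_true (x - y \in submod_pred)); rewrite e.
Qed.

Lemma quot_scale_pi a (x : M) : quot_scale a (qpi x) = qpi (a *: x).
Proof.
rewrite /quot_scale; apply/quot_piE; rewrite -scalerBr; apply: submodZ => //.
by apply/quot_piE; rewrite reprK.
Qed.

Lemma quot_piD (x y : M) : (qpi (x + y) : quot_type) = qpi x + qpi y.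
Proof. exact: (Quotient.pi_add (GRing.ZmodClosed.clone M submod_pred _) x y). Qed.

Lemma quot_pi_surj (q : quot_type) : exists x, q = qpi x.
Proof. by exists (repr q); rewrite reprK. Qed.

Fact quot_scaleA a b q : quot_scale a (quot_scale b q) = quot_scale (a * b) q.
Proof. by have [x ->] := quot_pi_surj q; rewrite !quot_scale_pi scalerA. Qed.
Fact quot_scale1 : left_id 1 quot_scale.
Proof. by move=> q; have [x ->] := quot_pi_surj q; rewrite quot_scale_pi scale1r. Qed.
Fact quot_scaleDr : right_distributive quot_scale +%R.
Proof.
move=> a p q; have [x ->] := quot_pi_surj p; have [y ->] := quot_pi_surj q.
by rewrite -quot_piD !quot_scale_pi scalerDr quot_piD.
Qed.
Fact quot_scaleDl q : {morph quot_scale^~ q : a b / a + b}.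
Proof. by move=> a b; have [x ->] := quot_pi_surj q; rewrite !quot_scale_pi scalerDl quot_piD. Qed.
HB.instance Definition _ := GRing.Zmodule_isLmodule.Build R quot_type
  quot_scaleA quot_scale1 quot_scaleDr quot_scaleDl.

Lemma quotient_module : exists (Q : lmodType R) (q : {linear M -> Q}),
  (forall z, exists x, q x = z) /\ forall x, q x = 0 <-> A x.
Proof.
have [|q qE] := @is_linear_bundle R M quot_type (fun x => qpi x).
  by move=> a x y; rewrite quot_piD -quot_scale_pi.
exists (quot_type : lmodType R), q; split=> [z|x].
  by exists (repr z); rewrite qE reprK.
rewrite -[0](linear0 q) !qE; split=> [/quot_piE|Ax]; first by rewrite subr0.
by apply/quot_piE; rewrite subr0.
Qed.

End SubquotientCarriers.

Lemma factor_through_surjection (R : pzRingType) (M N X : lmodType R)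
  (p : {linear M -> N}) (f : {linear M -> X}) :
  (forall z, exists x, p x = z) -> (forall x, p x = 0 -> f x = 0) ->
  exists g : {linear N -> X}, forall x, g (p x) = f x.
Proof.
move=> psurj pf; have [s ps] := choice psurj.
have fs x : f (s (p x)) = f x.
  by apply/eqP; rewrite -subr_eq0 -linearB; apply/eqP/pf; rewrite linearB ps subrr.
have [|g gE] := @is_linear_bundle R N X (f \o s); last first.
  by exists g => x; rewrite gE /= fs.
by move=> a x y /=; rewrite -{1}(ps x) -{1}(ps y) -!linearP fs.
Qed.

(** The coefficients serve the leading-term arguments and the last clause builds maps; that a map is
    determined by its values on [b] follows from the third clause. *)
Definition is_basis (R : pzRingType) (T : eqType) (L : lmodType R)
    (coef : L -> T -> R) (b : T -> L) : Prop :=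
  [/\ forall t, is_linear (coef^~ t : L -> R^o),
      forall t t', coef (b t) t' = (t == t')%:R,
      forall x, exists s, uniq s /\ x = \sum_(t <- s) coef x t *: b t
    & forall (X : lmodType R) (v : T -> X),
        exists g : {linear L -> X}, forall t, g (b t) = v t].

Section FreeModule.
Variables (R : pzRingType) (T : choiceType).

Definition finitely_supported (f : T -> R^o) : Prop :=
  exists s : seq T, forall t, t \notin s -> f t = 0.

Lemma finitely_supported_submodule : is_submodule finitely_supported.
Proof.
split; first by exists [::].
move=> a f g [s sf] [s' sg]; exists (s ++ s') => t.
rewrite mem_cat negb_or => /andP[ts ts'].
by rewrite addrfctE scalrfctE sf // sg // scaler0 addr0.
Qed.

Lemma free_module : exists (L : lmodType R) (coef : L -> T -> R) (b : T -> L),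
  is_basis coef b.
Proof.
have [L [i [i_inj iE]]] := submodule_carrier finitely_supported_submodule.
pose coef (x : L) (t : T) : R := i x t.
have coef_lin t : is_linear (coef^~ t : L -> R^o).
  by move=> a x y; rewrite /coef linearP addrfctE scalrfctE.
have fsupp x : exists s : seq T, forall t, t \notin s -> coef x t = 0.
  by apply/(iE (i x)); exists x.
have coef_inj x y : (forall t, coef x t = coef y t) -> x = y.
  by move=> xy; apply/i_inj/funext.
have bP t : exists u : L, forall t', coef u t' = (t == t')%:R.
  have /iE[u uE] : finitely_supported (fun t' => (t == t')%:R).
    by exists [:: t] => t'; rewrite inE eq_sym => /negPf->.
  by exists u => t'; rewrite /coef uE.
have [b bE] := choice bP.
have coef_sum (I : Type) (s : seq I) (F : I -> L) t :
    coef (\sum_(j <- s) F j) t = \sum_(j <- s) coef (F j) t.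
  by rewrite /coef linear_sum fct_sumE.
have coefZ a x t : coef (a *: x) t = a * coef x t.
  by rewrite /coef linearZ_LR scalrfctE.
have decomp x s : uniq s -> (forall t, t \notin s -> coef x t = 0) ->
    x = \sum_(t <- s) coef x t *: b t.
  move=> us sx; apply: coef_inj => t; rewrite coef_sum.
  case: (boolP (t \in s)) => ts; last first.
    rewrite sx // big_seq big1 // => t' t's; rewrite coefZ bE.
    by case: eqP => [e|]; [rewrite -e t's in ts | rewrite mulr0].
  rewrite (bigD1_seq t) //= coefZ bE eqxx mulr1 big1 ?addr0 // => t' /negPf t't.
  by rewrite coefZ bE t't mulr0.
exists L, coef, b; split => //.
  move=> x; have [s sx] := fsupp x; exists (undup s); rewrite undup_uniq.
  by split=> //; apply: decomp; rewrite ?undup_uniq // => t; rewrite mem_undup; exact: sx.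
move=> X v; have [S SP] := choice fsupp.
pose g x := \sum_(t <- undup (S x)) coef x t *: v t.
(* Any duplicate-free list containing the support gives the same value, so [x], [y] and [a *: x + y]
   can be summed over one common list. *)
have gE x s : uniq s -> (forall t, t \notin s -> coef x t = 0) ->
    g x = \sum_(t <- s) coef x t *: v t.
  move=> us sx; rewrite /g.
  have drop s' : \sum_(t <- s') coef x t *: v t =
      \sum_(t <- [seq t <- s' | coef x t != 0]) coef x t *: v t.
    rewrite big_filter [RHS]big_mkcond /=; apply: eq_bigr => t _.
    by case: eqP => //= ->; rewrite scale0r.
  rewrite drop [RHS]drop; apply: perm_big; apply: uniq_perm.
  - by rewrite filter_uniq ?undup_uniq.
  - by rewrite filter_uniq.
  move=> t; rewrite !mem_filter mem_undup; case: eqP => //= xt.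
  have -> : t \in S x by apply/negPn/negP => /SP.
  by apply/esym/negPn/negP => /sx.
have [|h hE] := @is_linear_bundle R L X g.
  move=> a x y; pose s := undup (S x ++ S y).
  have sP t : t \notin s -> coef x t = 0 /\ coef y t = 0.
    by rewrite mem_undup mem_cat negb_or => /andP[/SP-> /SP->].
  have us : uniq s by rewrite undup_uniq.
  rewrite (gE x s us) => [|t /sP[]//]; rewrite (gE y s us) => [|t /sP[]//].
  rewrite (gE _ s us) => [|t /sP[tx ty]]; last by rewrite coef_lin tx ty scaler0 addr0.
  rewrite scaler_sumr -big_split /=; apply: eq_bigr => t _.
  by rewrite coef_lin scalerDl scalerA.
exists h => t; rewrite hE (gE _ [:: t]) ?big_seq1 ?bE ?eqxx ?scale1r // => t'.
by rewrite inE bE eq_sym => /negPf->.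
Qed.

End FreeModule.

Section Basis.
Variables (R : pzRingType) (T : eqType) (L : lmodType R).
Variables (coef : L -> T -> R) (b : T -> L).
Hypothesis bL : is_basis coef b.

Lemma basis_ind (A : L -> Prop) :
  is_submodule A -> (forall t, A (b t)) -> forall x, A x.
Proof.
move=> sA Ab x; have [_ _ /(_ x)[s [_ ->]] _] := bL.
by apply: submod_sum => // t _; exact: submodZ.
Qed.

Lemma basis_eq (X : lmodType R) (f g : {linear L -> X}) :
  (forall t, f (b t) = g (b t)) -> f =1 g.
Proof.
move=> fg; apply: basis_ind fg; split=> [|a x y xe ye]; first by rewrite !linear0.
by rewrite !linearP xe ye.
Qed.

Lemma basis_lift (X Y : lmodType R) (p : {linear X -> Y}) (g : {linear L -> Y}) :
  (forall y, exists x, p x = y) ->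
  exists h : {linear L -> X}, forall x, p (h x) = g x.
Proof.
move=> /choice[s ps]; have [_ _ _ /(_ X (fun t => s (g (b t))))[h hb]] := bL.
by exists h; apply: (basis_eq (f := p \o h)) => t /=; rewrite hb ps.
Qed.

Lemma basis_coefB x y t : coef (x - y) t = coef x t - coef y t.
Proof.
have [coef_lin _ _ _] := bL; have [c cE] := is_linear_bundle (coef_lin t).
by rewrite -!cE linearB.
Qed.

Lemma basis_coefZ a x t : coef (a *: x) t = a * coef x t.
Proof.
have [coef_lin _ _ _] := bL; have [c cE] := is_linear_bundle (coef_lin t).
by rewrite -!cE linearZ_LR.
Qed.

Lemma basis_coef_sum (I : Type) (s : seq I) (P : pred I) (f : I -> L) t :
  coef (\sum_(i <- s | P i) f i) t = \sum_(i <- s | P i) coef (f i) t.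
Proof.
have [coef_lin _ _ _] := bL; have [c cE] := is_linear_bundle (coef_lin t).
by rewrite -cE linear_sum; apply: eq_bigr => i _; exact: cE.
Qed.

Lemma coef_basis t t' : coef (b t) t' = (t == t')%:R.
Proof. by case: bL. Qed.

Lemma basis_coef_inj x y : (forall t, coef x t = coef y t) -> x = y.
Proof.
move=> xy; apply: subr0_eq; have [_ _ /(_ (x - y))[s [_ ->]] _] := bL.
by rewrite big1 // => t _; rewrite basis_coefB xy subrr scale0r.
Qed.

End Basis.

Section NatBasis.
Variables (R : pzRingType) (L : lmodType R) (coef : L -> nat -> R) (b : nat -> L).
Hypothesis bL : is_basis coef b.

Lemma coef_bounded x : exists N, forall i, (N <= i)%N -> coef x i = 0.
Proof.
have [_ _ /(_ x)[s [_ xE]] _] := bL.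
exists (\max_(t <- s) t).+1 => i si; rewrite xE (basis_coef_sum bL) big_seq big1 // => t ts.
rewrite (basis_coefZ bL) (coef_basis bL); case: eqP => [ti|_]; last exact: mulr0.
by have := @leq_bigmax_seq _ _ xpredT id t ts isT; rewrite ti leqNgt si.
Qed.

Lemma basis_sum_below x N : (forall i, (N <= i)%N -> coef x i = 0) ->
  x = \sum_(i < N) coef x i *: b i.
Proof.
move=> xN; apply: (basis_coef_inj bL) => t; rewrite (basis_coef_sum bL).
have cE (i : 'I_N) : coef (coef x i *: b i) t = if val i == t then coef x t else 0.
  rewrite (basis_coefZ bL) (coef_basis bL); case: eqP => [->|_]; [exact: mulr1 | exact: mulr0].
under eq_bigr do rewrite cE.
case: (leqP N t) => tN; last first.
  rewrite (bigD1 (Ordinal tN)) //= eqxx big1 ?addr0 // => i.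
  by rewrite -val_eqE /= => /negPf ->.
by rewrite xN // big1 // => i _; case: eqP.
Qed.

End NatBasis.

(** * Localization at an element *)

Section Localization.
Variables (R : comPzRingType) (r : R).

(* A pair [(a, n)] stands for the fraction a / r^n. *)
Definition frac_rel (x y : R * nat) : bool :=
  `[< exists k, r ^+ k * (r ^+ y.2 * x.1) = r ^+ k * (r ^+ x.2 * y.1) >].

Fact frac_relP : equiv_class_of frac_rel.
Proof.
split=> [x|x y|y x z].
- by apply/asboolP; exists 0.
- by apply/asboolP/asboolP => -[k e]; exists k.
move=> /asboolP[k e] /asboolP[l e']; apply/asboolP; exists (k + l + y.2)%N.
rewrite !exprD.
transitivity (r ^+ l * r ^+ z.2 * (r ^+ k * (r ^+ y.2 * x.1))); first by ring.
rewrite e; transitivity (r ^+ k * r ^+ x.2 * (r ^+ l * (r ^+ z.2 * y.1))); first by ring.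
by rewrite e'; ring.
Qed.

Definition frac_equiv := EquivRelPack frac_relP.
Definition frac : Type := {eq_quot frac_equiv}.
HB.instance Definition _ := EqQuotient.on frac.
HB.instance Definition _ := Choice.on frac.

Definition mk_frac (x : R * nat) : frac := \pi_frac x.

Lemma mk_fracP x y : mk_frac x = mk_frac y <->
  exists k, r ^+ k * (r ^+ y.2 * x.1) = r ^+ k * (r ^+ x.2 * y.1).
Proof.
split=> [/eqmodP/asboolP//|e].
by apply/eqmodP/asboolP.
Qed.

Lemma mk_frac_surj q : exists x, q = mk_frac x.
Proof. by exists (repr q); rewrite /mk_frac reprK. Qed.

Definition frac_add (p q : frac) : frac := let x := repr p in let y := repr q in
  mk_frac (r ^+ y.2 * x.1 + r ^+ x.2 * y.1, (x.2 + y.2)%N).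
Definition frac_mul (p q : frac) : frac := let x := repr p in let y := repr q in
  mk_frac (x.1 * y.1, (x.2 + y.2)%N).
Definition frac_opp (p : frac) : frac := let x := repr p in mk_frac (- x.1, x.2).

Lemma repr_frac x : let x' := repr (mk_frac x) in
  exists k, r ^+ k * (r ^+ x.2 * x'.1) = r ^+ k * (r ^+ x'.2 * x.1).
Proof. by apply/mk_fracP; rewrite {1}/mk_frac reprK. Qed.

Lemma frac_addE x y : frac_add (mk_frac x) (mk_frac y) =
  mk_frac (r ^+ y.2 * x.1 + r ^+ x.2 * y.1, (x.2 + y.2)%N).
Proof.
rewrite /frac_add; set x' := repr (mk_frac x); set y' := repr (mk_frac y).
have [k ex] := repr_frac x; rewrite -/x' in ex.
have [l ey] := repr_frac y; rewrite -/y' in ey.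
clearbody x' y'.
apply/mk_fracP; exists (k + l)%N => /=; rewrite !exprD.
transitivity (r ^+ l * r ^+ y.2 * r ^+ y'.2 * (r ^+ k * (r ^+ x.2 * x'.1)) +
  r ^+ k * r ^+ x.2 * r ^+ x'.2 * (r ^+ l * (r ^+ y.2 * y'.1))); first by ring.
by rewrite ex ey; ring.
Qed.

Lemma frac_mulE x y : frac_mul (mk_frac x) (mk_frac y) =
  mk_frac (x.1 * y.1, (x.2 + y.2)%N).
Proof.
rewrite /frac_mul; set x' := repr (mk_frac x); set y' := repr (mk_frac y).
have [k ex] := repr_frac x; rewrite -/x' in ex.
have [l ey] := repr_frac y; rewrite -/y' in ey.
clearbody x' y'.
apply/mk_fracP; exists (k + l)%N => /=; rewrite !exprD.
transitivity ((r ^+ k * (r ^+ x.2 * x'.1)) * (r ^+ l * (r ^+ y.2 * y'.1))); first by ring.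
by rewrite ex ey; ring.
Qed.

Lemma frac_oppE x : frac_opp (mk_frac x) = mk_frac (- x.1, x.2).
Proof.
rewrite /frac_opp; set x' := repr (mk_frac x).
have [k ex] := repr_frac x; rewrite -/x' in ex.
by apply/mk_fracP; exists k => /=; rewrite !mulrN ex.
Qed.

Local Ltac frac_ring := apply/mk_fracP; exists 0%N => /=; rewrite ?exprD ?expr0; ring.

Fact frac_addA : associative frac_add.
Proof.
move=> p q s; have [x ->] := mk_frac_surj p; have [y ->] := mk_frac_surj q.
by have [z ->] := mk_frac_surj s; rewrite !frac_addE; frac_ring.
Qed.
Fact frac_addC : commutative frac_add.
Proof.
move=> p q; have [x ->] := mk_frac_surj p; have [y ->] := mk_frac_surj q.
by rewrite !frac_addE; frac_ring.
Qed.
Fact frac_add0 : left_id (mk_frac (0, 0%N)) frac_add.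
Proof. by move=> p; have [x ->] := mk_frac_surj p; rewrite frac_addE; frac_ring. Qed.
Fact frac_addN : left_inverse (mk_frac (0, 0%N)) frac_opp frac_add.
Proof.
by move=> p; have [x ->] := mk_frac_surj p; rewrite frac_oppE frac_addE; frac_ring.
Qed.
HB.instance Definition _ :=
  GRing.isZmodule.Build frac frac_addA frac_addC frac_add0 frac_addN.

Fact frac_mulA : associative frac_mul.
Proof.
move=> p q s; have [x ->] := mk_frac_surj p; have [y ->] := mk_frac_surj q.
by have [z ->] := mk_frac_surj s; rewrite !frac_mulE; frac_ring.
Qed.
Fact frac_mulC : commutative frac_mul.
Proof.
move=> p q; have [x ->] := mk_frac_surj p; have [y ->] := mk_frac_surj q.
by rewrite !frac_mulE; frac_ring.
Qed.
Fact frac_mul1 : left_id (mk_frac (1, 0%N)) frac_mul.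
Proof. by move=> p; have [x ->] := mk_frac_surj p; rewrite frac_mulE; frac_ring. Qed.
Fact frac_mulDl : left_distributive frac_mul frac_add.
Proof.
move=> p q s; have [x ->] := mk_frac_surj p; have [y ->] := mk_frac_surj q.
by have [z ->] := mk_frac_surj s; rewrite !(frac_mulE, frac_addE); frac_ring.
Qed.
HB.instance Definition _ := GRing.Zmodule_isComPzRing.Build frac
  frac_mulA frac_mulC frac_mul1 frac_mulDl.

Definition to_frac (a : R) : frac := mk_frac (a, 0%N).

Fact to_frac_additive : zmod_morphism to_frac.
Proof.
move=> a b; rewrite -[RHS]/(frac_add (to_frac a) (frac_opp (to_frac b))).
by rewrite frac_oppE frac_addE; frac_ring.
Qed.
Fact to_frac_monoid : monoid_morphism to_frac.
Proof.
split=> // a b; rewrite -[RHS]/(frac_mul (to_frac a) (to_frac b)).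
by rewrite frac_mulE; frac_ring.
Qed.
HB.instance Definition _ := GRing.isZmodMorphism.Build R frac to_frac to_frac_additive.
HB.instance Definition _ := GRing.isMonoidMorphism.Build R frac to_frac to_frac_monoid.

(** [r_contraadjusted] speaks of every model of the localization, so a model must be at hand before
    it yields any splitting. *)
Lemma localization_exists :
  exists (A : comPzRingType) (psi : {rmorphism R -> A}), is_localization r psi.
Proof.
exists (frac : comPzRingType), (to_frac : {rmorphism R -> frac}).
have inv n : to_frac r ^+ n * mk_frac (1, n) = 1.
  rewrite -rmorphXn; change (frac_mul (to_frac (r ^+ n)) (mk_frac (1, n)) = mk_frac (1, 0%N)).
  by rewrite frac_mulE; frac_ring.
split; first by exists (mk_frac (1, 1%N)); exact: (inv 1%N).
  move=> a; change (mk_frac (a, 0%N) = mk_frac (0, 0%N) <-> exists k, r ^+ k * a = 0).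
  split=> [/mk_fracP[k]|[k e]] /=; first by rewrite !mulr0 mul1r; exists k.
  by apply/mk_fracP; exists k => /=; rewrite mul1r e !mulr0.
move=> x; have [[a n] ->] := mk_frac_surj x; exists a, n.
suff -> : mk_frac (a, n) = to_frac a * mk_frac (1, n).
  by rewrite -mulrA [X in _ * X]mulrC -[RHS]mulr1; congr (_ * _); exact: inv.
by change (mk_frac (a, n) = frac_mul (to_frac a) (mk_frac (1, n))); rewrite frac_mulE; frac_ring.
Qed.

End Localization.

(** * Contraadjusted modules and telescopes *)

Definition eventually (P : nat -> Prop) : Prop := exists N, forall n, (N <= n)%N -> P n.

Lemma eventually_and (P Q : nat -> Prop) :
  eventually P -> eventually Q -> eventually (fun n => P n /\ Q n).
Proof.
move=> [N HN] [N' HN']; exists (maxn N N') => n; rewrite geq_max => /andP[h h'].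
by split; [exact: HN | exact: HN'].
Qed.

Lemma eventuallyW (P Q : nat -> Prop) :
  (forall n, P n -> Q n) -> eventually P -> eventually Q.
Proof. by move=> PQ [N HN]; exists N => n /HN/PQ. Qed.

Lemma eventually_ex (P : nat -> Prop) : eventually P -> exists n, P n.
Proof. by case=> N /(_ N (leqnn N)); exists N. Qed.

(** This quotient of a countable power serves twice: a direct limit is found inside it, and it turns
    solutions of finite systems into solutions of countable ones. *)
Lemma germ_module (R : pzRingType) (M : lmodType R) :
  exists (G : lmodType R) (germ : {linear (nat -> M) -> G}),
    (forall z, exists x, germ x = z) /\
    forall x y, germ x = germ y <-> eventually (fun n => x n = y n).
Proof.
have [|G [germ [gsurj gE]]] :=
    @quotient_module R (nat -> M) (fun x => eventually (fun n => x n = 0)).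
  split; first by exists 0%N.
  move=> a x y ex ey; apply: eventuallyW (eventually_and ex ey) => n [xn yn].
  by rewrite addrfctE scalrfctE xn yn scaler0 addr0.
exists G, germ; split=> // x y; split=> [xy|xy].
  have /gE : germ (x - y) = 0 by rewrite linearB xy subrr.
  by apply: eventuallyW => n; rewrite addrfctE opprfctE => /subr0_eq.
apply: subr0_eq; rewrite -linearB; apply/gE.
by apply: eventuallyW xy => n; rewrite addrfctE opprfctE => ->; rewrite subrr.
Qed.

Lemma recursion_from (T : Type) (step : nat -> T -> T) (n : nat) (v : T) :
  exists x : nat -> T, x n = v /\ forall k, (n <= k)%N -> x k.+1 = step k (x k).
Proof.
(* Entries before [n] are filler: only the tail counts for a germ. *)
pose fix x k := if k is k'.+1 then (if (n <= k')%N then step k' (x k') else v) else v.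
exists x; split=> [|k nk /=]; last by rewrite nk.
have xv m : (m <= n)%N -> x m = v by case: m => //= m mn; rewrite leqNgt mn.
exact: xv.
Qed.

(* The sequence form of [Ext^1(R[s^-1], C) = 0] for all [s], coming from the
   presentation of [R[s^-1]] by generators [e_n] with [e_n = s e_(n+1)]. *)
Definition solves_telescopes (R : pzRingType) (C : lmodType R) : Prop :=
  forall (s : R) (c : nat -> C), exists b : nat -> C,
    forall n, b n = c n + s *: b n.+1.

Section Telescope.
Variables (R : comPzRingType) (r : R) (C : lmodType R) (c : nat -> C).
Variables (A : comPzRingType) (psi : {rmorphism R -> A}).
Hypothesis locA : is_localization r psi.

Let V := (C * R^o)%type.
(** A pair [(x, a)] at position [n] stands for [x + a e_n]; [step n] rewrites it by
    [e_n = c_n + r e_(n+1)]. *)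
Let step n (v : V) : V := (v.1 + v.2 *: c n, r * v.2).

Let stepP n a (v v' : V) : step n (a *: v + v') = a *: step n v + step n v'.
Proof.
congr pair => /=; last by rewrite mulrDr; congr +%R; exact: mulrCA.
by rewrite scalerDl scalerDr scalerA addrACA.
Qed.

(* The extension of [R[r^-1]] by [C] with lifts [e_n] of [r^-n] such that
   [e_n - r e_(n+1) = c_n], realised as the direct limit of [C + R] along the
   maps [step n], i.e. as germs of eventually compatible sequences. *)
Lemma telescope_extension_solution :
  ext1_zero (restr psi A^o) C -> exists b : nat -> C,
    forall n, b n = c n + r *: b n.+1.
Proof.
move=> ext0; have [[u ru] ker_psi frac_psi] := locA.
pose w n : A := u ^+ n.
have rw n : psi r ^+ n * w n = 1 by rewrite /w -exprMn ru expr1n.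
have rwS n : psi r * w n.+1 = w n by rewrite /w exprS mulrA ru mul1r.
have [G [germ [gsurj gE]]] := @germ_module R V.
pose compat (x : nat -> V) := eventually (fun n => x n.+1 = step n (x n)).
pose B z := exists2 x, z = germ x & compat x.
have [|E [j [j_inj jE]]] := @submodule_carrier R G B.
  split=> [|a _ _ [x -> cx] [y -> cy]].
    exists 0; rewrite ?linear0 //; exists 0%N => n _ /=.
    by congr pair; rewrite /= ?scale0r ?mulr0 ?addr0.
  exists (a *: x + y); rewrite ?linearP //.
  apply: eventuallyW (eventually_and cx cy) => n [xn yn].
  by rewrite !addrfctE !scalrfctE stepP xn yn.
have liftE x : compat x -> exists e, j e = germ x by move=> cx; apply/jE; exists x.
have /choice[i iE] a : exists e, j e = germ (fun=> (a, 0) : V).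
  by apply: liftE; exists 0%N => n _; congr pair; rewrite /= ?scale0r ?addr0 ?mulr0.
have i_lin : is_linear i.
  move=> a x y; apply: j_inj; rewrite linearP !iE -linearP; congr (germ _).
  apply/funext => n; rewrite addrfctE scalrfctE; congr pair.
  by rewrite /= scaler0 addr0.
have [i' i'E] := is_linear_bundle i_lin.
have i'_inj : injective i'.
  move=> x y; rewrite !i'E => e; have : germ (fun=> (x, 0) : V) = germ (fun=> (y, 0)).
    by rewrite -!iE e.
  by move=> /gE/eventually_ex[n []].
(* The projection to the localization reads the second entry at position [n] as a numerator over
   [r^n]; along a compatible sequence this fraction is constant. *)
pose val (e : E) (v : A) := exists2 x, j e = germ x &
  eventually (fun n => x n.+1 = step n (x n) /\ v = psi (x n).2 * w n).
have val_fun e v v' : val e v -> val e v' -> v = v'.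
  move=> [x ex cx] [y ey cy].
  have /gE exy : germ x = germ y by rewrite -ex -ey.
  have [n [[xy [_ ->]] [_ ->]]] :=
    eventually_ex (eventually_and (eventually_and exy cx) cy).
  by rewrite xy.
have valI e x N : j e = germ x -> (forall n, (N <= n)%N -> x n.+1 = step n (x n)) ->
    val e (psi (x N).2 * w N).
  move=> ex cx; exists x => //; exists N => n Nn; split; first exact: cx.
  rewrite -(subnK Nn) addnC; elim: (n - N)%N => [|k IH]; first by rewrite addn0.
  rewrite IH addnS cx ?leq_addr //= rmorphM -(rwS (N + k)%N); ring.
have /choice[p pE] e : exists v, val e v.
  have [x ex [N cx]] : B (j e) by apply/jE; exists e.
  by exists (psi (x N).2 * w N); exact: valI ex cx.
have p_uniq e v : val e v -> p e = v by move=> ev; exact: val_fun (pE e) ev.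
have [|p' p'E] := @is_linear_bundle R E (restr psi A^o) p.
  move=> a e e'; apply: p_uniq; have [x ex cx] := pE e; have [y ey cy] := pE e'.
  exists (a *: x + y); first by rewrite !linearP ex ey.
  apply: eventuallyW (eventually_and cx cy) => n [[xS px] [yS py]].
  rewrite !addrfctE !scalrfctE stepP xS yS px py; split=> //.
  by rewrite /= rmorphD rmorphM mulrDl -mulrA.
have ext n : exists e, exists x, [/\ j e = germ x, x n = (0, 1) &
    forall k, (n <= k)%N -> x k.+1 = step k (x k)].
  have [x [x0 cx]] := recursion_from step n (0, 1).
  by have [|e ex] := liftE x; [exists n | exists e, x].
have [e eP] := choice ext.
have pe n : p' (e n) = w n.
  have [x [ex x0 cx]] := eP n.
  by rewrite p'E (p_uniq _ _ (valI _ _ _ ex cx)) x0 rmorph1 mul1r.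
have e_step n : e n - r *: e n.+1 = i' (c n).
  have [x [ex x0 cx]] := eP n; have [y [ey y0 cy]] := eP n.+1.
  apply: j_inj; rewrite i'E iE linearB linearZ_LR ex ey -linearZ -linearB.
  apply/gE; exists n.+1 => k nk; rewrite -(subnK nk) addnC.
  elim: (k - n.+1)%N => [|m IH].
    rewrite addn0 addrfctE opprfctE scalrfctE y0 cx // x0.
    congr pair; rewrite /= ?scale1r ?add0r ?scaler0 ?subr0 //; exact: subrr.
  have cxm := cx (n.+1 + m)%N; have cym := cy (n.+1 + m)%N.
  rewrite addnS; move: IH; rewrite !addrfctE !opprfctE !scalrfctE cxm ?cym; try lia.
  set ck := c (n.+1 + m)%N; move: (x _) (y _) => [x1 x2] [y1 y2] [h1 h2].
  have {}h2 : x2 = r * y2 by apply: (@subr0_eq R); exact: h2.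
  congr pair; last by rewrite /= h2; exact: subrr.
  change (x1 + x2 *: ck - r *: (y1 + y2 *: ck) = c n).
  by rewrite h2 scalerDr scalerA opprD addrACA subrr addr0; exact: h1.
have p_exact z : p' z = 0 <-> exists a, z = i' a.
  split=> [pz|[a ->]]; last first.
    rewrite p'E; apply: p_uniq; exists (fun=> (a, 0)); first by rewrite i'E.
    exists 0%N => n _; rewrite rmorph0 mul0r; split=> //.
    by congr pair; rewrite /= ?scale0r ?addr0 ?mulr0.
  have [x zx [N cx]] := pE z; rewrite -p'E pz in cx.
  have [_ /esym xN] := cx N (leqnn N).
  (* If the fraction is 0, some [r^k] kills the second entry at [N]. It is then 0 from position
     [N + k] on, where the first entry no longer changes and gives the element of [C]. *)
  have /ker_psi[k xk] : psi (x N).2 = 0.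
    by rewrite -[psi _]mulr1 -(rw N) [psi r ^+ N * _]mulrC mulrA xN mul0r.
  have x2 m : (x (N + m)%N).2 = r ^+ m * (x N).2.
    elim: m => [|m IH]; first by rewrite addn0 mul1r.
    by rewrite addnS (proj1 (cx _ _)) ?leq_addr //= IH mulrA -exprS.
  have x2k m : (k <= m)%N -> (x (N + m)%N).2 = 0.
    by move=> km; rewrite x2 -(subnK km) exprD -mulrA xk mulr0.
  exists (x (N + k)%N).1; apply: j_inj; rewrite zx i'E iE; apply/gE.
  exists (N + k)%N => n nk; rewrite -(subnK nk) addnC; elim: (n - _)%N => [|m IH].
    by rewrite addn0 -(x2k k) //; case: (x _).
  rewrite addnS (proj1 (cx _ _)); last by lia.
  by rewrite IH /step /= scale0r addr0 mulr0.
have [m|s sP] := ext0 E i' p' i'_inj _ p_exact.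
  have [a [n mE]] := frac_psi m.
  exists (a *: e n); rewrite linearZ_LR pe.
  change (psi a * w n = m); rewrite -mE -mulrA rw mulr1 //.
(* The splitting satisfies [s (w n) = r s (w (n+1))], while [e] satisfies this only up to [c n];
   hence the difference, with its sign changed, solves the telescope. *)
have /choice[d dE] n : exists d, s (w n) - e n = i' d.
  by apply/p_exact; rewrite linearB sP pe subrr.
exists (fun n => - d n) => n; apply: i'_inj.
rewrite scalerN linearB linearZ_LR [LHS]linearN -!dE -e_step.
have -> : s (w n) = r *: s (w n.+1).
  by rewrite -linearZ_LR; congr (s _); exact: esym (rwS n).
by rewrite scalerBr !opprB addrA subrK.
Qed.
End Telescope.

Lemma contraadjusted_solves_telescopes (R : comPzRingType) (C : lmodType R) :
  contraadjusted C -> solves_telescopes C.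
Proof.
move=> hC s c; have [A [psi locA]] := localization_exists s.
exact: (telescope_extension_solution c locA (hC s A psi locA)).
Qed.

(** * Divisible parts and devissage *)

(** A map out of a submodule is a function on the whole module with arbitrary values outside [A],
    which avoids a separate carrier for [A]. *)
Definition linear_on (R : pzRingType) (M N : lmodType R) (A : M -> Prop)
    (f : M -> N) : Prop :=
  forall a x y, A x -> A y -> f (a *: x + y) = a *: f x + f y.

Definition extendable (R : pzRingType) (M : lmodType R) (A : M -> Prop)
    (X : lmodType R) : Prop :=
  forall f : M -> X, linear_on A f ->
    exists g : {linear M -> X}, forall x, A x -> g x = f x.

(** The form in which flatness of the quotient by [A] is used when [M] is free of countable rank
    over a Noetherian ring. *)
Definition locally_split (R : pzRingType) (M : lmodType R) (A : M -> Prop) : Prop :=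
  exists phi : nat -> {linear M -> M}, (forall n x, A (phi n x)) /\
    forall x, A x -> eventually (fun n => phi n x = x).

Definition bounded_torsion (R : pzRingType) (r : R) (M : lmodType R) : Prop :=
  exists k, forall j (x : M), r ^+ j *: x = 0 -> r ^+ k *: x = 0.

Lemma linear_onB (R : comPzRingType) (M N : lmodType R) (A : M -> Prop)
  (f : M -> N) (r : R) (g : {linear M -> N}) :
  linear_on A f -> linear_on A (fun x => f x - r *: g x).
Proof.
move=> fl a x y Ax Ay; rewrite fl // linearP scalerDr opprD scalerBr !scalerA.
by rewrite [r * a]mulrC addrACA.
Qed.

Lemma solves_telescopes_quotient (R : pzRingType) (M N : lmodType R)
  (p : {linear M -> N}) : (forall y, exists x, p x = y) ->
  solves_telescopes M -> solves_telescopes N.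
Proof.
move=> /choice[s ps] hM r c; have [b bE] := hM r (s \o c).
by exists (p \o b) => n; rewrite /= {1}bE linearD linearZ_LR ps.
Qed.

Section DivisiblePart.
Variables (R : comPzRingType) (r : R) (P : lmodType R).
Hypotheses (hP : solves_telescopes P) (torsP : bounded_torsion r P).

Definition divisible_part (x : P) : Prop := forall n, exists y, x = r ^+ n *: y.

Lemma multiples_submodule (s : R) : is_submodule (fun x : P => exists y, x = s *: y).
Proof.
split; first by exists 0; rewrite scaler0.
move=> a _ _ [x ->] [y ->]; exists (a *: x + y).
by rewrite scalerDr !scalerA mulrC.
Qed.

Lemma divisible_part_submodule : is_submodule divisible_part.
Proof.
split=> [n|a x y Dx Dy n]; first exact: (submod0 (multiples_submodule _)).
by have [_ h] := multiples_submodule (r ^+ n); apply: h; [exact: Dx | exact: Dy].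
Qed.

Lemma divisible_part_inj x : divisible_part x -> r *: x = 0 -> x = 0.
Proof.
case: torsP => k hk Dx rx; have [y xE] := Dx k.
by rewrite xE; apply: (hk k.+1); rewrite exprS -scalerA -xE.
Qed.

(** Write [x = r^n y_n] for all [n]. The difference of [y_(k+1)] and [r^m y_(m+k+1)] is killed by
    [r^(k+1)], hence by [r^k]; so [r^k y_(k+1)] is a multiple of every [r^m]. *)
Lemma divisible_part_surj x :
  divisible_part x -> exists2 z, divisible_part z & x = r *: z.
Proof.
case: torsP => k hk Dx; have /choice[y yE] := Dx.
exists (r ^+ k *: y k.+1); last by rewrite scalerA -exprS -yE.
move=> m; exists (r ^+ k *: y (m + k.+1)%N).
apply/eqP; rewrite -subr_eq0 scalerA mulrC -scalerA -scalerBr; apply/eqP.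
apply: (hk k.+1); rewrite scalerBr scalerA -exprD [(k.+1 + m)%N]addnC.
by rewrite -!yE subrr.
Qed.

(* To solve [b n = c n + s b (n+1)] inside the divisible part, solve the
   telescope of [r s] for [r^-n c n] and rescale: then [b (n + m)] is a multiple
   of [r^m], and so is [b n], as it differs from [s^m b (n + m)] by a
   combination of the [c]'s. *)
Lemma divisible_part_telescopes (s : R) (c : nat -> P) :
  (forall n, divisible_part (c n)) ->
  exists b, (forall n, divisible_part (b n)) /\ forall n, b n = c n + s *: b n.+1.
Proof.
move=> Dc; have /choice[c' c'E] n : exists y, c n = r ^+ n *: y by exact: Dc.
have [b bE] := hP (r * s) c'.
have step n : r ^+ n *: b n = c n + s *: (r ^+ n.+1 *: b n.+1).
  by rewrite {1}bE scalerDr -c'E !scalerA exprS; congr (_ + _ *: _); ring.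
exists (fun n => r ^+ n *: b n); split=> // n m.
have sub := multiples_submodule (r ^+ m).
have [d] : exists d, r ^+ n *: b n = d + s ^+ m *: (r ^+ (n + m) *: b (n + m)%N)
    /\ divisible_part d.
  elim: m {sub} => [|m [d [IH Dd]]].
    by exists 0; rewrite add0r addn0 scale1r; split=> //; exact: (submod0 divisible_part_submodule).
  exists (d + s ^+ m *: c (n + m)%N); split.
    by rewrite IH step scalerDr addrA addnS scalerA -exprSr.
  have sD := divisible_part_submodule.
  by apply: (submodD sD) => //; apply: (submodZ sD).
case=> -> Dd; apply: (submodD sub); first exact: Dd.
apply: (submodZ sub); exists (r ^+ n *: b (n + m)%N).
by rewrite scalerA -exprD addnC.
Qed.

End DivisiblePart.

Definition acts_bijectively (R : pzRingType) (r : R) (M : lmodType R) : Prop :=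
  (forall x : M, r *: x = 0 -> x = 0) /\ forall x : M, exists y, x = r *: y.

Section Devissage.
Variables (R : comPzRingType) (L0 : lmodType R) (coef : L0 -> nat -> R) (b : nat -> L0).
Hypothesis bL0 : is_basis coef b.
Variable Om : L0 -> Prop.
Hypothesis sOm : is_submodule Om.

(* [P] is complete for its filtration by the [r^n P], so a map is extended by
   successive approximation modulo [r^n P], up to an error in the intersection. *)
Lemma extendable_devissage (r : R) (P U : lmodType R) (i : {linear U -> P}) :
  solves_telescopes P -> injective i ->
  (forall x, divisible_part r x <-> exists u, i u = x) ->
  (forall (Q : lmodType R) (q : {linear P -> Q}), (forall z, exists x, q x = z) ->
     (forall z : Q, r *: z = 0) -> extendable Om Q) ->
  extendable Om U -> extendable Om P.
Proof.
move=> hP i_inj iE extQ extU f f_lin.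
pose good n (h : L0 -> P) := linear_on Om h /\
  forall x, Om x -> exists y, h x = r ^+ n *: y.
have step (nh : nat * (L0 -> P)) : exists g : {linear L0 -> P}, good nh.1 nh.2 ->
    good nh.1.+1 (fun x => nh.2 x - r ^+ nh.1 *: g x).
  case: nh => n h /=; have [[h_lin hn]|ng] := EM (good n h); last by exists \0.
  (* The element [h' x] with [h x = r^n h' x] is not unique, but its class modulo this submodule is,
     so [q \o h'] is linear on [Om]. Moreover [r] kills [Q]. *)
  have [|Q [q [q_surj qE]]] :=
      @quotient_module R P (fun x => exists y, r ^+ n *: x = r ^+ n.+1 *: y).
    split; first by exists 0; rewrite !scaler0.
    move=> a x y [x' ex] [y' ey]; exists (a *: x' + y').
    by rewrite !scalerDr scalerA mulrC -scalerA ex ey !scalerA [a * _]mulrC.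
  have /choice[h' h'E] x : exists y, Om x -> h x = r ^+ n *: y.
    by have [/hn[y]|] := EM (Om x); [exists y | exists 0].
  have h'_lin : linear_on Om (q \o h').
    move=> a x y Ox Oy; rewrite /= -linearP; apply/eqP.
    rewrite -subr_eq0 -linearB; apply/eqP/qE; exists 0.
    rewrite scaler0 scalerBr scalerDr !scalerA [_ * a]mulrC -scalerA.
    rewrite -!h'E // ?h_lin // ?subrr //.
    by case: sOm => _; apply.
  have [|g gE] := extQ Q q q_surj _ _ h'_lin.
    move=> z; have [x <-] := q_surj z; rewrite -linearZ_LR; apply/qE.
    by exists x; rewrite scalerA -exprSr.
  have [g' g'E] := basis_lift bL0 g q_surj.
  exists g' => _; split; first exact: linear_onB.
  move=> x Ox; rewrite h'E // -scalerBr.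
  have /qE[y yE] : q (h' x - g' x) = 0 by rewrite linearB g'E gE // subrr.
  by exists y.
have [G GP] := choice step.
pose fix F n : L0 -> P := if n is n'.+1 then
  fun x => F n' x - r ^+ n' *: G (n', F n') x else f.
have goodF n : good n (F n).
  elim: n => [|n IH]; last exact: (GP (n, F n)).
  by split=> // x _; exists (f x); rewrite scale1r.
(* Telescopes replace convergence: [beta n] stands for the sum over [j >= n] of
   [r^(j-n) G (j, F j)], taken at a basis element and then extended linearly. *)
have /choice[beta betaE] t : exists beta : nat -> P,
    forall n, beta n = G (n, F n) (b t) + r *: beta n.+1 by exact: hP.
have [_ _ _ ext] := bL0.
have /choice[g gE] n : exists g : {linear L0 -> P}, forall t, g (b t) = beta t n.
  exact: ext.
have g_step n x : g n x = G (n, F n) x + r *: g n.+1 x.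
  move: x; have rl : is_linear (fun x => G (n, F n) x + r *: g n.+1 x).
    by move=> a x y; rewrite !linearP scalerDr addrACA.
  have [g' g'E] := is_linear_bundle rl.
  by move=> x; rewrite -g'E; apply: (basis_eq bL0) => t; rewrite g'E !gE betaE.
have F_g n x : f x - g 0%N x = F n x - r ^+ n *: g n x.
  elim: n => [|n ->] /=; first by rewrite scale1r.
  by rewrite {1}g_step scalerDr opprD addrA scalerA -exprSr.
(* By [F_g] the remaining error lies in every [r^n P], hence comes from [U]. *)
have /choice[e eE] x : exists u, Om x -> i u = f x - g 0%N x.
  have [Ox|] := EM (Om x); last by exists 0.
  have [|u uE] := (iE (f x - g 0%N x)).1; last by exists u.
  move=> n; rewrite (F_g n); have [_ /(_ x Ox)[y ->]] := goodF n.
  by exists (y - g n x); rewrite scalerBr.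
have e_lin : linear_on Om e.
  move=> a x y Ox Oy; apply: i_inj; rewrite linearP !eE //; last first.
    by case: sOm => _; apply.
  by rewrite f_lin // linearP scalerBr opprD addrACA.
have [h hE] := extU e e_lin.
have [|g' g'E] := @is_linear_bundle R L0 P (fun x => i (h x) + g 0%N x).
  by move=> a x y; rewrite !linearP scalerDr addrACA.
by exists g' => x Ox; rewrite g'E hE // eE // subrK.
Qed.

(* [P] is the module of germs of sequences in [L] whose image in [C] is
   eventually constant; reduced powers solve all countable systems of linear
   equations that are finitely solvable. *)
Lemma telescope_cover (C L : lmodType R) (p : {linear L -> C}) :
  (forall y, exists x, p x = y) -> solves_telescopes C ->
  exists (P : lmodType R) (pi : {linear P -> C}),
  [/\ solves_telescopes P,
      forall r, bounded_torsion r L -> bounded_torsion r P,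
      forall r, (forall x : L, r *: x = 0) -> forall x : P, r *: x = 0
    & locally_split Om -> extendable Om P -> extendable Om C].
Proof.
move=> p_surj hC; have [G [germ [gsurj gE]]] := @germ_module R L.
pose lim (l : nat -> L) (c : C) := eventually (fun n => p (l n) = c).
have lim_uniq l c c' : lim l c -> lim l c' -> c = c'.
  by move=> h h'; have [n [<- <-]] := eventually_ex (eventually_and h h').
have lim_germ l l' c : germ l = germ l' -> lim l c -> lim l' c.
  move=> /gE e h; apply: eventuallyW (eventually_and e h) => n [en <-].
  by rewrite en.
have limP a l l' c c' : lim l c -> lim l' c' -> lim (a *: l + l') (a *: c + c').
  move=> h h'; apply: eventuallyW (eventually_and h h') => n [<- <-].
  by rewrite addrfctE scalrfctE linearP.
have [|P [j [j_inj jE]]] :=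
    @submodule_carrier R G (fun z => exists l c, z = germ l /\ lim l c).
  split; first by exists 0, 0; rewrite linear0; split=> //; exists 0%N => n _; rewrite linear0.
  move=> a _ _ [l [c [-> lc]]] [l' [c' [-> lc']]].
  by exists (a *: l + l'), (a *: c + c'); rewrite linearP; split=> //; exact: limP.
have /choice[pi piE] z : exists c, forall l, j z = germ l -> lim l c.
  have [l [c [zl lc]]] : exists l c, j z = germ l /\ lim l c by apply/jE; exists z.
  by exists c => l' zl'; apply: lim_germ lc; rewrite -zl.
have pi_lin : is_linear pi.
  move=> a x y; have [l lx] := gsurj (j x); have [l' ly] := gsurj (j y).
  have e : j (a *: x + y) = germ (a *: l + l') by rewrite !linearP lx ly.
  apply: lim_uniq (piE _ _ e) _; apply: limP; exact: piE.
have [pi' pi'E] := is_linear_bundle pi_lin.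
exists P, pi'; split.
- move=> s c; have [lam lamE] := choice p_surj.
  have [bb bbE] := hC s (pi \o c).
  (* The representatives are altered at finitely many places so that their images in [C] are
     constant throughout. *)
  have /choice[l lP] n : exists l : nat -> L, j (c n) = germ l /\ forall m, p (l m) = pi (c n).
    have [l lx] := gsurj (j (c n)); have [N cN] := piE (c n) l (esym lx).
    exists (fun m => if (N <= m)%N then l m else lam (pi (c n))); split.
      by rewrite -lx; apply/gE; exists N => m ->.
    by move=> m; case: ifP => [/cN|].
  (* At coordinate [n] the equations are solved downwards, starting from a lift of [bb (n+1)];
     [T n d] is the value of the unknown of index [n + 1 - d]. *)
  pose fix T n d : L := if d is d'.+1 then l (n - d')%N n + s *: T n d' else lam (bb n.+1).
  have pT n d : (d <= n.+1)%N -> p (T n d) = bb (n.+1 - d)%N.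
    elim: d => [|d IH] dn /=; first by rewrite lamE subn0.
    rewrite linearD linearZ_LR IH 1?ltnW // (lP _).2 subSS.
    by rewrite [in RHS]bbE subSn.
  (* The coordinates [n] with [n + 1 < k] are filler. The equation of index [k] holds at every
     coordinate from [k] on, which suffices for germs. *)
  pose B k n : L := if (k <= n.+1)%N then T n (n.+1 - k)%N else lam (bb k).
  have pB k n : p (B k n) = bb k.
    by rewrite /B; case: ifP => kn; rewrite ?lamE // pT ?leq_subr // subKn.
  have /choice[z zE] k : exists z, j z = germ (B k).
    by apply/jE; exists (B k), (bb k); split=> //; exists 0%N.
  exists z => k; apply: j_inj; rewrite linearD linearZ_LR !zE (lP k).1 -linearZ -linearD.
  apply/gE; exists k => n kn; rewrite addrfctE scalrfctE /B ltnS kn leqW //.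
  by rewrite subSS subSn //= subKn.
- move=> r [k hk]; exists k => m x mx; have [l lx] := gsurj (j x).
  have jZ a : j (a *: x) = germ (a *: l) by rewrite linearZ_LR -lx -linearZ_LR.
  have /gE e : germ (r ^+ m *: l) = germ 0 by rewrite -jZ mx !linear0.
  apply: j_inj; rewrite jZ linear0 -(linear0 germ); apply/gE.
  by apply: eventuallyW e => n; exact: hk.
- move=> r rL x; apply: j_inj; have [l lx] := gsurj (j x).
  rewrite linearZ_LR linear0 -lx -linearZ_LR -(linear0 germ); congr (germ _).
  by apply/funext => n; exact: rL.
move=> [phi [phiO phi_id]] extP f f_lin.
(* Unlike [f], the map [f \o phi n] is linear on all of [L0], so it lifts to [L]. For [x] in [Om]
   the lifts form a sequence whose images are eventually [f x]. *)
have /choice[h hE] n : exists h : {linear L0 -> L}, forall x, p (h x) = f (phi n x).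
  have [|f' f'E] := @is_linear_bundle R L0 C (f \o phi n).
    by move=> a x y; rewrite /= linearP f_lin.
  by have [h hE] := basis_lift bL0 f' p_surj; exists h => x; rewrite hE f'E.
pose H x : nat -> L := fun n => h n x.
have limH x : Om x -> lim (H x) (f x).
  by move=> /phi_id; apply: eventuallyW => n e; rewrite /H hE e.
have /choice[F FE] x : exists z, Om x -> j z = germ (H x).
  have [Ox|] := EM (Om x); last by exists 0.
  have [z zE] : exists z, j z = germ (H x).
    by apply/jE; exists (H x), (f x); split=> //; exact: limH.
  by exists z.
have F_lin : linear_on Om F.
  move=> a x y Ox Oy; apply: j_inj; rewrite linearP !FE //; last by case: sOm => _; apply.
  by rewrite -linearP; congr (germ _); apply/funext => n; rewrite /H linearP.
have [g gF] := extP F F_lin.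
exists (pi' \o g) => x Ox /=; rewrite gF // pi'E.
exact: lim_uniq (piE _ _ (FE _ Ox)) (limH x Ox).
Qed.

End Devissage.

(** * Noetherian induction *)

Section Ideals.
Variable R : comPzRingType.

Lemma ideal_submodule (I : R -> Prop) : is_ideal I -> is_submodule (I : R^o -> Prop).
Proof.
by case=> I0 ID IM; split=> // a x y Ix Iy; apply: ID => //; exact: IM.
Qed.

Lemma submodule_ideal (I : R -> Prop) : is_submodule (I : R^o -> Prop) -> is_ideal I.
Proof.
move=> sI; split; first exact: (submod0 sI).
  by move=> x y; exact: (submodD sI).
by move=> a x; exact: (submodZ sI).
Qed.

Lemma ideal_generator (I : R -> Prop) (s : seq R) :
  (forall x, I x <-> exists c : 'I_(size s) -> R, x = \sum_(i < size s) c i * s`_i) ->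
  forall i : 'I_(size s), I s`_i.
Proof.
move=> sI i; apply/sI; exists (fun j => (j == i)%:R).
rewrite (bigD1 i) //= eqxx mul1r big1 ?addr0 // => j /negPf ->.
by rewrite mul0r.
Qed.

Hypothesis noethR : noetherian R.

Lemma ascending_ideals (J : nat -> R -> Prop) :
  (forall n, is_ideal (J n)) -> (forall n x, J n x -> J n.+1 x) ->
  exists N, forall n x, J n x -> J N x.
Proof.
move=> idJ Jup.
have mono m n x : (m <= n)%N -> J m x -> J n x.
  by move=> /subnK <-; elim: (n - m)%N => [|k IH] // Jm; apply: Jup; exact: IH.
have idU : is_ideal (fun x => exists n, J n x).
  split; first by exists 0%N; case: (idJ 0%N).
    move=> x y [m Jx] [n Jy]; exists (maxn m n); case: (idJ (maxn m n)) => _ JD _.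
    by apply: JD; [exact: mono (leq_maxl _ _) Jx | exact: mono (leq_maxr _ _) Jy].
  by move=> a x [n Jx]; exists n; case: (idJ n) => _ _; exact.
have [s sU] := noethR idU; have /choice[k kP] := ideal_generator sU.
pose N := (\max_(i < size s) k i)%N; exists N => n x Jx.
have [|c ->] := (sU x).1; first by exists n.
apply: (submod_sum (ideal_submodule (idJ N))) => i _; case: (idJ N) => _ _; apply.
exact: mono (leq_bigmax i) (kP i).
Qed.

Lemma ideal_induction (P : (R -> Prop) -> Prop) :
  (forall I, is_ideal I -> (forall J, is_ideal J -> (forall x, I x -> J x) ->
     (exists2 x, J x & ~ I x) -> P J) -> P I) ->
  forall I, is_ideal I -> P I.
Proof.
move=> step I idI; apply: contrapT => nPI.
pose bad J := is_ideal J /\ ~ P J.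
have /choice[next nextP] J : exists J', bad J ->
    [/\ bad J', forall x, J x -> J' x & exists2 x, J' x & ~ J x].
  have [[idJ nPJ]|] := EM (bad J); last by exists J.
  apply: contrapT => none; apply: nPJ; apply: step => // J' idJ' JJ' new.
  by apply: contrapT => nPJ'; apply: none; exists J'.
have badn n : bad (iter n next I) by elim: n => //= n /nextP[].
have [|n x|N max] := @ascending_ideals (fun n => iter n next I).
- by move=> n; case: (badn n).
- by have [_ h _] := nextP _ (badn n); exact: h.
by have [_ _ [x Jx]] := nextP _ (badn N); apply; exact: (max N.+1).
Qed.

(** The ideals [(I : r^j)] form an ascending chain. This bounds the [r]-torsion of free modules over
    [R/I]. *)
Lemma ideal_saturation (I : R -> Prop) (r : R) : is_ideal I ->
  exists k, forall j a, I (r ^+ j * a) -> I (r ^+ k * a).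
Proof.
move=> /ideal_submodule sI.
apply: (@ascending_ideals (fun j a => I (r ^+ j * a))) => [n|n x Ix].
  apply: submodule_ideal; split; first by rewrite mulr0; exact: (submod0 sI).
  move=> a x y Ix Iy; have -> : r ^+ n * (a *: (x : R^o) + y) = a *: (r ^+ n * x : R^o) + r ^+ n * y.
    by rewrite mulrDr mulrCA.
  by apply: (submodD sI) => //; exact: (submodZ sI).
by rewrite exprS -mulrA; exact: (submodZ sI).
Qed.

Lemma ideal_adjoin (I : R -> Prop) (r : R) : is_ideal I ->
  exists J, [/\ is_ideal J, forall x, I x -> J x, J r &
    forall x, J x -> exists i c, I i /\ x = i + c * r].
Proof.
move=> [I0 ID IM]; exists (fun x => exists i c, I i /\ x = i + c * r); split=> //.
- split; first by exists 0, 0; rewrite mul0r addr0.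
    move=> _ _ [i [c [Ii ->]]] [j [d [Ij ->]]]; exists (i + j), (c + d).
    by rewrite mulrDl addrACA; split=> //; exact: ID.
  move=> a _ [i [c [Ii ->]]]; exists (a * i), (a * c).
  by rewrite mulrDr mulrA; split=> //; exact: IM.
- by move=> x Ix; exists x, 0; rewrite mul0r addr0.
by exists 0, 1; rewrite mul1r add0r.
Qed.

(** By induction on [n]: the coefficients at [n] of the elements of [A] supported up to [n] form a
    finitely generated ideal, and subtracting a combination of elements realising its generators
    removes the coefficient at [n]. *)
Lemma finitely_generated_below (L0 : lmodType R) (coef : L0 -> nat -> R)
    (b : nat -> L0) (A : L0 -> Prop) (n : nat) :
  is_basis coef b -> is_submodule A ->
  exists s : seq L0, (forall z, z \in s -> A z) /\
    forall B, is_submodule B -> (forall z, z \in s -> B z) ->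
      forall x, A x -> (forall i, (n <= i)%N -> coef x i = 0) -> B x.
Proof.
move=> bL0 sA; have [coef_lin _ decomp _] := bL0.
have coef0 i : coef 0 i = 0 by rewrite -(scale0r (0 : L0)) (basis_coefZ bL0) mul0r.
elim: n => [|n [s [As sP]]].
  exists [::]; split=> // B sB _ x _ x0.
  have [s [_ ->]] := decomp x; rewrite big1 => [|t _]; first exact: submod0.
  by rewrite x0 // scale0r.
pose below m x := forall i, (m <= i)%N -> coef x i = 0.
have sbelow m : is_submodule (below m).
  by split=> [i _ //|a x y bx by_ i mi]; rewrite coef_lin bx // by_ // addr0; exact: mulr0.
have idJ : is_ideal (fun a => exists x, [/\ A x, below n.+1 x & coef x n = a]).
  apply: submodule_ideal; split.
    by exists 0; split=> //; exact: submod0.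
  move=> a _ _ [x [Ax bx <-]] [y [Ay by_ <-]]; exists (a *: x + y); split; last exact: coef_lin.
    by case: sA => _; exact.
  by case: (sbelow n.+1) => _; exact.
have [g gJ] := noethR idJ; have /choice[y yP] := ideal_generator gJ.
exists (codom y ++ s); split.
  by move=> z; rewrite mem_cat => /orP[/codomP[j ->]|/As//]; case: (yP j).
move=> B sB Bs x Ax bx.
have [|c cE] := (gJ (coef x n)).1; first by exists x.
pose z := \sum_(i < size g) c i *: y i.
have Bz : B z.
  apply: (submod_sum sB) => i _; apply: (submodZ sB); apply: Bs.
  by rewrite mem_cat codom_f.
rewrite -[x](subrK z); apply: (submodD sB) => //; apply: sP => //.
- by move=> u us; apply: Bs; rewrite mem_cat us orbT.
- apply: (submodB sA) => //; apply: (submod_sum sA) => i _; apply: (submodZ sA).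
  by case: (yP i).
have bz : below n.+1 (x - z).
  apply: (submodB (sbelow _)) => //; apply: (submod_sum (sbelow _)) => i _.
  by apply: (submodZ (sbelow _)); case: (yP i).
move=> i; rewrite leq_eqVlt => /orP[/eqP<-|]; last exact: bz.
rewrite (basis_coefB bL0) (basis_coef_sum bL0) cE; apply/eqP; rewrite subr_eq0; apply/eqP.
by apply: eq_bigr => j _; rewrite (basis_coefZ bL0); case: (yP j) => _ _ ->.
Qed.

(* The cover is free over [R/I]. *)
Lemma bounded_torsion_cover (I : R -> Prop) (C : lmodType R) : is_ideal I ->
  (forall a (x : C), I a -> a *: x = 0) ->
  exists (L : lmodType R) (p : {linear L -> C}),
  [/\ forall y, exists x, p x = y, forall r, bounded_torsion r L
    & forall a (x : L), I a -> a *: x = 0].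
Proof.
move=> idI IC; have sI := ideal_submodule idI.
have [Fr [coef [b bFr]]] := free_module R C.
have [coef_lin _ decomp ext] := bFr; have coefZ := basis_coefZ bFr.
have [|L [q [q_surj qE]]] := @quotient_module R Fr (fun x => forall t, I (coef x t)).
  split=> [t|a x y Ix Iy t].
    by rewrite -(scale0r (0 : Fr)) coefZ mul0r; exact: (submod0 sI).
  by rewrite coef_lin; case: sI => _; exact.
have [p0 p0E] := ext C id.
have [|p pE] := factor_through_surjection (p := q) (f := p0) q_surj.
  move=> x /qE Ix; have [s [_ ->]] := decomp x; rewrite linear_sum big1 // => t _.
  by rewrite linearZ_LR IC.
exists L, p; split.
- by move=> y; exists (q (b y)); rewrite pE p0E.
- move=> r; have [k kP] := ideal_saturation r idI; exists k => j x.
  have [x' <-] := q_surj x; rewrite -!linearZ_LR => /qE h; apply/qE => t.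
  by rewrite coefZ; apply: (kP j); rewrite -coefZ; exact: h.
move=> a x Ia; have [x' <-] := q_surj x; rewrite -linearZ_LR; apply/qE => t.
by rewrite coefZ mulrC; exact: (submodZ sI).
Qed.

Lemma extendable_contraadjusted (L0 : lmodType R) (coef : L0 -> nat -> R)
    (b : nat -> L0) (Om : L0 -> Prop) :
  is_basis coef b -> is_submodule Om -> locally_split Om ->
  (forall I : R -> Prop, is_ideal I -> ~ I 1 -> (forall a c, I (a * c) -> I a \/ I c) ->
     exists2 a, ~ I a & forall G : lmodType R, (forall d (x : G), I d -> d *: x = 0) ->
       acts_bijectively a G -> extendable Om G) ->
  forall C : lmodType R, solves_telescopes C -> extendable Om C.
Proof.
move=> bL0 sOm splitOm generic C hC.
suff main I : is_ideal I -> forall C : lmodType R, solves_telescopes C ->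
    (forall a (x : C), I a -> a *: x = 0) -> extendable Om C.
  apply: (main (fun a => a = 0)) => //; last by move=> _ x ->; exact: scale0r.
  by split=> // [x y -> ->|a x ->]; rewrite ?addr0 ?mulr0.
apply: (ideal_induction (P := fun I => forall C : lmodType R, solves_telescopes C ->
    (forall a (x : C), I a -> a *: x = 0) -> extendable Om C)) => {}I idI IH {hC}C hC IC.
have [I1|nI1] := EM (I 1).
  move=> f _; exists \0 => x _; rewrite -[LHS]scale1r -[RHS]scale1r.
  by rewrite !IC.
have [r nIr divr] : exists2 r, ~ I r & forall U : lmodType R, solves_telescopes U ->
    (forall d (x : U), I d -> d *: x = 0) -> acts_bijectively r U -> extendable Om U.
  have [prI|nprI] := EM (forall a c, I (a * c) -> I a \/ I c).
    by have [a nIa aG] := generic I idI nI1 prI; exists a => // U _; exact: aG.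
  have [a [c [Iac nIa nIc]]] : exists a c, [/\ I (a * c), ~ I a & ~ I c].
    apply: contrapT => none; apply: nprI => a c Iac.
    have [Ia|nIa] := EM (I a); first by left.
    by right; apply: contrapT => nIc; apply: none; exists a, c.
  (* Since [a] is surjective on [U] and [a * c] kills [U], so does [c], and the induction hypothesis
     for [J] applies. *)
  exists a => // U hU IU [_ surj_a]; have [J [idJ IJ Jc JE]] := ideal_adjoin c idI.
  apply: (IH J) => //; first by exists c.
  move=> d x /JE[j [e [Ij ->]]]; rewrite scalerDl IU // add0r.
  have [y ->] := surj_a x; rewrite scalerA -mulrA [c * a]mulrC -scalerA.
  by rewrite (IU (a * c)) // scaler0.
have [J [idJ IJ Jr JE]] := ideal_adjoin r idI.
have [L [p [p_surj torsL IL]]] := bounded_torsion_cover idI IC.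
have [P [pi [hP torsP killP liftP]]] := telescope_cover bL0 sOm p_surj hC.
apply: liftP => //.
have IP d (x : P) : I d -> d *: x = 0.
  by move=> Id; apply: killP => y; exact: IL.
have {}torsP := torsP r (torsL r).
have sD := divisible_part_submodule r P.
have [U [i [i_inj iE]]] := submodule_carrier sD.
apply: (extendable_devissage bL0 sOm hP i_inj iE).
  move=> Q q q_surj rQ; apply: (IH J) => //; first by exists r.
    exact: solves_telescopes_quotient q_surj hP.
  move=> d x /JE[j [c [Ij ->]]]; rewrite scalerDl -scalerA rQ scaler0 addr0.
  by have [x' <-] := q_surj x; rewrite -linearZ_LR IP // linear0.
apply: divr.
- move=> s c; have [bb [Dbb bbE]] := divisible_part_telescopes hP (r := r) s (c := i \o c) (fun n => (iE _).2 (ex_intro _ (c n) erefl)).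
  have /choice[b' b'E] n : exists u, i u = bb n by apply/iE.
  by exists b' => n; apply: i_inj; rewrite linearD linearZ_LR !b'E.
- by move=> d x Id; apply: i_inj; rewrite linearZ_LR linear0 IP.
split=> x.
  move=> rx; apply: i_inj; rewrite linear0; apply: (divisible_part_inj torsP).
    by apply/iE; exists x.
  by rewrite -linearZ_LR rx linear0.
have [|z /iE[u <-] xz] := divisible_part_surj torsP (x := i x); first by apply/iE; exists x.
by exists u; apply: i_inj; rewrite linearZ_LR.
Qed.

End Ideals.

(** * Flatness *)

Section FlatLifting.
Variables (R : comPzRingType) (F : lmodType R).

Lemma bilin_linear_left (N W : lmodType R) (g : F -> N -> W) : bilin g ->
  forall u, exists h : {linear F -> W}, forall x, h x = g x u.
Proof. by case=> gl _ u; exact: is_linear_bundle (gl u). Qed.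

Lemma bilin_linear_right (N W : lmodType R) (g : F -> N -> W) : bilin g ->
  forall x, exists h : {linear N -> W}, forall u, h u = g x u.
Proof. by case=> _ gr x; exact: is_linear_bundle (gr x). Qed.

Lemma bilin_sum_right (N W : lmodType R) (g : F -> N -> W) (I : finType)
  (c : I -> R) (u : I -> N) x :
  bilin g -> \sum_i g (c i *: x) (u i) = g x (\sum_i c i *: u i).
Proof.
move=> gb; have [h hE] := bilin_linear_right gb x.
rewrite -hE linear_sum; apply: eq_bigr => i _; rewrite linearZ_LR hE.
by have [h' h'E] := bilin_linear_left gb (u i); rewrite -!h'E linearZ_LR.
Qed.

Definition unit_vector n (i : 'I_n) : 'I_n -> R^o := fun i' => (i' == i)%:R.

Lemma sum_unit_vector_fun n (M : lmodType R) (v : 'I_n -> M) :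
  v = \sum_k (fun i => unit_vector k i *: v k).
Proof.
apply/funext => i; rewrite fct_sumE (bigD1 i) //= /unit_vector eqxx scale1r.
by rewrite big1 ?addr0 // => k; rewrite eq_sym => /negPf ->; rewrite scale0r.
Qed.

Lemma unit_vector_decomposition n (k : 'I_n -> R^o) :
  \sum_i k i *: unit_vector i = k.
Proof.
apply/funext => i; rewrite fct_sumE (bigD1 i) //= scalrfctE /unit_vector eqxx.
rewrite big1 ?addr0 => [|k']; first exact: mulr1.
by rewrite eq_sym scalrfctE => /negPf ->; exact: mulr0.
Qed.

Lemma linear_unit_vector n (M : lmodType R) (f : {linear ('I_n -> R^o) -> M})
  (k : 'I_n -> R^o) : f k = \sum_i k i *: f (unit_vector i).
Proof.
rewrite -[k in LHS]unit_vector_decomposition linear_sum.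
by apply: eq_bigr => i _; exact: linearZ_LR.
Qed.

(** [flat] accepts any model of the tensor products; this concrete one makes vanishing in it a
    statement about coordinates. *)
Lemma tensor_free m : @is_tensor_product R F ('I_m -> R^o) ('I_m -> F)
  (fun x t => fun j => t j *: x).
Proof.
split.
  split=> [t a x y|x a t t']; apply/funext => j; rewrite addrfctE scalrfctE.
    by rewrite scalerDr !scalerA mulrC.
  by rewrite addrfctE scalrfctE scalerDl -scalerA.
move=> W g gb; split.
  have [|h hE] := @is_linear_bundle R ('I_m -> F) W
      (fun y => \sum_j g (y j) (@unit_vector m j)).
    move=> a y y'; rewrite scaler_sumr -big_split; apply: eq_bigr => j _ /=.
    by have [k kE] := bilin_linear_left gb (@unit_vector m j); rewrite -!kE linearP.
  exists h => x t; rewrite hE bilin_sum_right //; congr g.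
  exact: unit_vector_decomposition.
move=> h1 h2 h1E h2E y; rewrite [y]sum_unit_vector_fun !linear_sum.
by apply: eq_bigr => j _; rewrite h1E h2E.
Qed.

(* The equational criterion for flatness, phrased as a lifting of solutions
   along [pi]; it comes from comparing F (x) N -> F (x) R^m for the image N of
   the matrix [a], where F (x) N is F^n modulo the span of the [k u] with
   [a k = 0]. *)
Lemma flat_lifting (L : lmodType R) (pi : {linear L -> F}) (m n : nat)
    (a : 'I_m -> 'I_n -> R) (x : 'I_n -> F) :
  flat F -> (forall y, exists l, pi l = y) ->
  (forall j, \sum_i a j i *: x i = 0) ->
  exists v : 'I_n -> L, (forall i, pi (v i) = x i) /\
    forall j, \sum_i a j i *: v i = 0.
Proof.
move=> flatF pi_surj ax.
pose amap (t : 'I_n -> R^o) : 'I_m -> R^o := fun j => \sum_i t i * a j i.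
have [|al alE] := @is_linear_bundle R ('I_n -> R^o) ('I_m -> R^o) amap.
  move=> c t t'; apply/funext => j; rewrite addrfctE scalrfctE /amap.
  transitivity (c * (\sum_i t i * a j i) + \sum_i t' i * a j i); last by [].
  rewrite mulr_sumr -big_split; apply: eq_bigr => i _ /=.
  by rewrite mulrDl; congr (_ + _); exact: esym (mulrA _ _ _).
have [|N [io [io_inj ioE]]] :=
    @submodule_carrier R ('I_m -> R^o) (fun w => exists t, w = al t).
  split; first by exists 0; rewrite linear0.
  by move=> c _ _ [t ->] [t' ->]; exists (c *: t + t'); rewrite linearP.
have /choice[nu nuE] i : exists u, io u = al (unit_vector i) by apply/ioE; eexists.
have /choice[tau tauE] u : exists t, al t = io u.
  by have [t ->] : exists t, io u = al t; [apply/ioE; exists u | exists t].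
have tau_nu u : \sum_i tau u i *: nu i = u.
  apply: io_inj; rewrite linear_sum -tauE linear_unit_vector.
  by apply: eq_bigr => i _; rewrite linearZ_LR nuE.
(* The span of the [k u] with [a k = 0], written as an intersection of submodules so that membership
   can be applied to any submodule [B]. *)
pose W (y : 'I_n -> F) := forall B : ('I_n -> F) -> Prop, is_submodule B ->
  (forall k u, al k = 0 -> B (fun i => k i *: u)) -> B y.
have sW : is_submodule W.
  split=> [B sB _|c y y' Wy Wy' B sB Bk]; first exact: submod0.
  by case: (sB) => _; apply; [exact: Wy | exact: Wy'].
have [T [q [q_surj qE]]] := quotient_module sW.
have q_eq k k' u : al k = al k' -> q (fun i => k i *: u) = q (fun i => k' i *: u).
  move=> kk'; apply: subr0_eq; rewrite -linearB; apply/qE => B sB.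
  move=> /(_ (k - k') u); rewrite linearB kk' subrr => /(_ erefl).
  by congr B; apply/funext => i; rewrite !addrfctE !opprfctE scalerBl.
pose b y u := q (fun i => tau u i *: y).
have b_bilin : bilin b.
  split=> [u c y y'|y c u u']; rewrite /b.
    rewrite -linearP; congr (q _); apply/funext => i.
    by rewrite addrfctE scalrfctE scalerDr !scalerA mulrC.
  rewrite -linearP (@q_eq _ (c *: tau u + tau u')); last by rewrite linearP !tauE linearP.
  congr (q _); apply/funext => i.
  by rewrite !addrfctE !scalrfctE scalerDl -scalerA.
have q_decomp y : q y = \sum_i b (y i) (nu i).
  rewrite [y in LHS]sum_unit_vector_fun linear_sum; apply: eq_bigr => i _.
  by apply: q_eq; rewrite tauE nuE.
have b_tensor : is_tensor_product b.
  split=> // X g gb; split; last first.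
    move=> h1 h2 h1E h2E z; have [y <-] := q_surj z.
    by rewrite q_decomp !linear_sum; apply: eq_bigr => i _; rewrite h1E h2E.
  have [|h hE] := @is_linear_bundle R ('I_n -> F) X (fun y => \sum_i g (y i) (nu i)).
    move=> c y y'; rewrite scaler_sumr -big_split; apply: eq_bigr => i _ /=.
    by have [k kE] := bilin_linear_left gb (nu i); rewrite -!kE linearP.
  have [|h' h'E] := factor_through_surjection (p := q) (f := h) q_surj.
    move=> y /qE/(_ (fun y => h y = 0)); apply.
      by split=> [|c z z' hz hz']; rewrite ?linear0 // linearP hz hz' scaler0 addr0.
    move=> k u k0; rewrite hE bilin_sum_right //.
    have -> : \sum_i k i *: nu i = 0.
      apply: io_inj; rewrite linear0 -k0 linear_sum.
      by rewrite linear_unit_vector; apply: eq_bigr => i _; rewrite linearZ_LR nuE.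
    by have [k' k'E] := bilin_linear_right gb u; rewrite -k'E linear0.
  by exists h' => y u; rewrite h'E hE bilin_sum_right // tau_nu.
pose b' (y : F) (t : 'I_m -> R^o) : 'I_m -> F := fun j => t j *: y.
have b'_tensor : is_tensor_product b' := tensor_free m.
have [|[h hE] _] := b_tensor.2 _ (fun y u => b' y (io u)).
  have [[bl br] _] := b'_tensor; split=> [u|y]; first exact: bl.
  by move=> c u u'; rewrite linearP; exact: br.
(* By flatness [h] is injective, and it sends the class of [x] to the tuple of the sums in [ax],
   which is 0. *)
have Wx : W x.
  apply/qE; apply: (flatF N _ io io_inj _ _ _ _ b_tensor b'_tensor h hE).
  rewrite linear0 q_decomp linear_sum; apply/funext => j; rewrite fct_sumE -[RHS](ax j).
  apply: eq_bigr => i _; rewrite hE nuE alE /b' /amap; congr (_ *: _).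
  rewrite (bigD1 i) //= /unit_vector eqxx mul1r big1 ?addr0 // => k /negPf ->.
  exact: mul0r.
(* The tuples that lift to solutions in [L] form a submodule, and [k u] with [a k = 0] lifts through
   any preimage of [u]. *)
apply: (Wx (fun x => exists v : 'I_n -> L, (forall i, pi (v i) = x i) /\
    forall j, \sum_i a j i *: v i = 0)).
  split; first by exists 0; split=> [i|j]; rewrite ?linear0 // big1 // => i _; exact: scaler0.
  move=> c y y' [v [vy av]] [v' [v'y av']]; exists (c *: v + v'); split=> [i|j].
    by rewrite !addrfctE !scalrfctE linearP vy v'y.
  transitivity (c *: \sum_i a j i *: v i + \sum_i a j i *: v' i).
    rewrite scaler_sumr -big_split; apply: eq_bigr => i _ /=.
    by rewrite !addrfctE !scalrfctE scalerDr !scalerA mulrC.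
  by rewrite av av' scaler0 addr0.
move=> k u k0; have [l lu] := pi_surj u.
exists (fun i => k i *: l); split=> [i|j]; first by rewrite linearZ_LR lu.
have := congr1 (fun t => t j) k0; rewrite alE /amap => akj.
rewrite (eq_bigr (fun i => (k i * a j i) *: l)) => [|i _]; last by rewrite scalerA mulrC.
by rewrite -scaler_suml akj scale0r.
Qed.

End FlatLifting.

(** For finitely many relations, [flat_lifting] yields [v i] with the same image as [b i] that
    satisfy these relations; then [b i - v i] lies in the kernel, and sending [b i] there fixes
    them. The [n]-th map treats generators of the relations supported below [n]. *)
Lemma flat_locally_split (R : comPzRingType) (F L0 : lmodType R)
    (coef : L0 -> nat -> R) (b : nat -> L0) (pi : {linear L0 -> F}) :
  noetherian R -> is_basis coef b -> (forall y, exists x, pi x = y) -> flat F ->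
  locally_split (fun x => pi x = 0).
Proof.
move=> noethR bL0 pi_surj flatF; have [_ _ decomp ext] := bL0.
have sOm : is_submodule (fun x => pi x = 0).
  by split=> [|a x y x0 y0]; rewrite ?linear0 // linearP x0 y0 scaler0 addr0.
have split1 (s : seq L0) : (forall z, z \in s -> pi z = 0) ->
    exists phi : {linear L0 -> L0}, (forall x, pi (phi x) = 0) /\
      forall z, z \in s -> phi z = z.
  move=> s0; have /choice[B BP] := coef_bounded bL0.
  pose N := \max_(z <- s) B z.
  have sN z i : z \in s -> (N <= i)%N -> coef z i = 0.
    by move=> zs Ni; apply: BP; apply: leq_trans Ni; exact: (leq_bigmax_seq z zs isT).
  have zE z : z \in s -> z = \sum_(i < N) coef z i *: b i.
    by move=> zs; apply: (basis_sum_below bL0) => i; exact: sN.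
  have [j|v [vb av]] := @flat_lifting R F L0 pi (size s) N
      (fun j i => coef s`_j i) (fun i => pi (b i)) flatF pi_surj.
    rewrite -[RHS](s0 s`_j (mem_nth 0 (ltn_ord j))) [in RHS](zE _ (mem_nth 0 (ltn_ord j))).
    by rewrite linear_sum; apply: eq_bigr => i _; rewrite linearZ_LR.
  (* Basis elements of index at least [N] occur in no member of the list and are sent to 0. *)
  have [phi phiE] := ext L0 (fun k => if insub k is Some i then b k - v i else 0).
  exists phi; split.
    apply: (basis_ind bL0 (A := fun x => pi (phi x) = 0)).
      by split=> [|c x y x0 y0]; rewrite ?linear0 // !linearP x0 y0 scaler0 addr0.
    by move=> k; rewrite phiE; case: insubP => [i _ <-|_]; rewrite ?linear0 // linearB vb subrr.
  move=> z zs; have zlt : (index z s < size s)%N by rewrite index_mem.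
  have := av (Ordinal zlt); rewrite /= nth_index // => vz.
  rewrite {1}(zE z zs) linear_sum (eq_bigr (fun i : 'I_N => coef z i *: b i - coef z i *: v i)).
    by rewrite sumrB vz subr0 -zE.
  by move=> i _; rewrite linearZ_LR phiE (valK i) scalerBr.
have /choice[phi phiP] n : exists phi : {linear L0 -> L0}, (forall x, pi (phi x) = 0) /\
    forall x, pi x = 0 -> (forall i, (n <= i)%N -> coef x i = 0) -> phi x = x.
  have [s [s0 sP]] := finitely_generated_below noethR n bL0 sOm.
  have [phi [phi0 phis]] := split1 s s0; exists phi; split=> // x x0 xn.
  apply: (sP (fun x => phi x = x)) => //.
  by split=> [|c y z yE zE]; rewrite ?linear0 // linearP yE zE.
exists phi; split=> [n x|x x0]; first by case: (phiP n).
have [N xN] := coef_bounded bL0 x; exists N => n Nn; case: (phiP n) => _; apply=> // i ni.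
by apply: xN; exact: leq_trans ni.
Qed.

(** * Generic freeness *)

(** Course-of-values recursion with a choice at each stage. Earlier values are passed as a total
    function, and the second hypothesis says that only those below [n] count. *)
Lemma strong_recursion (X : Type) (x0 : X) (P : nat -> (nat -> X) -> X -> Prop) :
  (forall n h, exists y, P n h y) ->
  (forall n h h' y, (forall i, (i < n)%N -> h i = h' i) -> P n h y -> P n h' y) ->
  exists g, forall n, P n g (g n).
Proof.
move=> ex ext.
have /choice[step stepP] (nh : nat * (nat -> X)) : exists y, P nh.1 nh.2 y.
  exact: ex.
pose fix T n : seq X := if n is k.+1 then rcons (T k) (step (k, nth x0 (T k))) else [::].
have sT n : size (T n) = n by elim: n => //= n IH; rewrite size_rcons IH.
have nT k i : (i < k)%N -> nth x0 (T k) i = nth x0 (T i.+1) i.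
  elim: k => // k IH; rewrite ltnS leq_eqVlt => /orP[/eqP-> //|ik].
  by rewrite [T k.+1]/= nth_rcons sT ik IH.
exists (fun n => nth x0 (T n.+1) n) => n.
rewrite [T n.+1]/= nth_rcons sT ltnn eqxx.
by apply: ext (stepP (n, nth x0 (T n))) => i; exact: nT.
Qed.

Section Generic.
Variables (R : comPzRingType) (L0 : lmodType R) (coef : L0 -> nat -> R) (b : nat -> L0).
Hypothesis bL0 : is_basis coef b.
Variables (Om : L0 -> Prop) (I : R -> Prop).
Hypotheses (sOm : is_submodule Om) (splitOm : locally_split Om) (idI : is_ideal I).

(* The relation [x], read modulo [I], has no terms after the [n]-th. *)
Definition leads_at (n : nat) (x : L0) : Prop :=
  Om x /\ forall i, (n < i)%N -> I (coef x i).

(* An extension is determined, and can be chosen, one basis element at a time: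
   freely if no relation leads there, and otherwise by one such relation, whose
   leading coefficient divides [a]. Flatness enters as [Om /\ I L0 = I Om]. *)
Lemma extendable_leading (a : R) (G : lmodType R) :
  (forall n x, leads_at n x -> ~ I (coef x n) ->
     exists y, leads_at n y /\ exists d, coef y n * d = a) ->
  (forall d (x : G), I d -> d *: x = 0) -> acts_bijectively a G -> extendable Om G.
Proof.
move=> lead IG [a_inj a_surj] f f_lin.
pose good n y := leads_at n y /\ exists d, coef y n * d = a.
have /choice[w wP] n : exists y, (exists y, good n y) -> good n y.
  by have [[y gy]|] := EM (exists y, good n y); [exists y | exists 0].
have cw_inj n : good n (w n) -> forall z : G, coef (w n) n *: z = 0 -> z = 0.
  by case=> _ [d da] z cz; apply: a_inj; rewrite -da mulrC -scalerA cz scaler0.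
have [gam gamP] : exists gam : nat -> G, forall n, good n (w n) ->
    coef (w n) n *: gam n = f (w n) - \sum_(i < n) coef (w n) i *: gam i.
  apply: (@strong_recursion G 0 (fun n h y => good n (w n) ->
      coef (w n) n *: y = f (w n) - \sum_(i < n) coef (w n) i *: h i)) => [n h|n h h' y hh'].
    have [[gw [d da]]|] := EM (good n (w n)); last by exists 0.
    have [z zE] := a_surj (f (w n) - \sum_(i < n) coef (w n) i *: h i).
    by exists (d *: z); rewrite scalerA da zE.
  move=> e gn; rewrite e //; congr (_ - _); apply: eq_bigr => i _.
  by rewrite hh'.
have [_ _ _ /(_ G gam)[g gE]] := bL0.
have sumE x : exists N, forall (h : {linear L0 -> G}) M, (N <= M)%N ->
    h x = \sum_(i < M) coef x i *: h (b i).
  have [N xN] := coef_bounded bL0 x; exists N => h M NM.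
  have xM i : (M <= i)%N -> coef x i = 0 by move=> Mi; apply: xN; exact: leq_trans Mi.
  rewrite {1}(basis_sum_below bL0 xM) linear_sum.
  by apply: eq_bigr => i _; exact: linearZ_LR.
have g_w n : good n (w n) -> g (w n) = f (w n).
  move=> gw; have [N sN] := sumE (w n); have [[_ hi] _] := gw.
  rewrite (sN g (N + n.+1)%N) ?leq_addr // addnC big_split_ord /= [X in _ + X]big1 ?addr0; last first.
    by move=> i _; apply: IG; apply: hi; rewrite ltnS leq_addr.
  rewrite (eq_bigr (fun i : 'I_n.+1 => coef (w n) i *: gam i)) => [|i _]; last by rewrite gE.
  by rewrite big_ord_recr /= gamP // addrC subrK.
have sI := ideal_submodule idI.
have vanish (h : {linear L0 -> G}) x : (forall i, I (coef x i)) -> h x = 0.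
  move=> Ix; have [N /(_ h N (leqnn N)) ->] := sumE x.
  by apply: big1 => i _; exact: IG.
suff main N x : Om x -> (forall i, (N <= i)%N -> I (coef x i)) -> g x = f x.
  exists g => x Ox; have [N xN] := coef_bounded bL0 x.
  by apply: (main N) => // i /xN->; exact: (submod0 sI).
elim: N x => [|N IH] x Ox Ix.
  have {}Ix i : I (coef x i) by exact: Ix.
  (* The map [f \o phi n] is linear on all of [L0], so it kills elements with coefficients in [I];
     as [phi n] fixes [x], this gives [f x = 0]. *)
  have [phi [phiO /(_ x Ox)/eventually_ex[n xE]]] := splitOm.
  have [|h hE] := @is_linear_bundle R L0 G (f \o phi n).
    by move=> c y z; rewrite /= linearP f_lin.
  by rewrite vanish // -xE -[f _]hE vanish.
have [Ic|nIc] := EM (I (coef x N)).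
  by apply: IH => // i; rewrite leq_eqVlt => /orP[/eqP<-|]//; exact: Ix.
have gw : good N (w N) by apply: wP; apply: lead nIc; split.
have [[Ow wI] _] := gw; set c := coef (w N) N; set e := coef x N.
(* Cross-multiplication cancels the terms at [N]. The factor [c] can be removed at the end because
   it divides [a] and so acts injectively on [G]. *)
have Oy : Om (c *: x - e *: w N) by apply: submodB => //; exact: submodZ.
have gy : g (c *: x - e *: w N) = f (c *: x - e *: w N).
  apply: IH => // i; rewrite (basis_coefB bL0) !(basis_coefZ bL0) leq_eqVlt => /orP[/eqP<-|Ni].
    by rewrite -/c -/e [e * c]mulrC subrr; exact: (submod0 sI).
  by apply: (submodB sI); apply: (submodZ sI); [exact: Ix | exact: wI].
have fy : f (c *: x - e *: w N) = c *: f x - e *: f (w N).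
  have f0 : f 0 = 0.
    have := f_lin 1 0 0 (submod0 sOm) (submod0 sOm).
    by rewrite !scale1r addr0 => /(congr1 (fun z => z - f 0)); rewrite addrK subrr.
  have fZ d y : Om y -> f (d *: y) = d *: f y.
    by move=> Oy'; rewrite -[d *: y]addr0 f_lin // ?f0 ?addr0 //; exact: (submod0 sOm).
  by rewrite -scaleNr f_lin // ?fZ ?scaleNr //; apply: (submodN sOm); exact: (submodZ sOm).
apply: subr0_eq; apply: (cw_inj N gw); rewrite -/c scalerBr; apply/eqP.
rewrite subr_eq0; apply/eqP; move: gy.
by rewrite fy linearB !linearZ_LR g_w // => /addIr.
Qed.

End Generic.

(** * Monomial order and Dickson's lemma *)

Fixpoint partial_sum (k : nat) (m : nat -> nat) : nat :=
  if k is k'.+1 then (partial_sum k' m + m k')%N else 0%N.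

(* The rank of an exponent vector in the order comparing total degrees first,
   then the total degrees of the first [k - 1] entries, and so on. *)
Fixpoint monomial_rank (k : nat) (m : nat -> nat) : nat :=
  if k is k'.+1 then ('C(partial_sum k m + k', k) + monomial_rank k' m)%N else 0%N.

Lemma monomial_rankS k m : monomial_rank k.+1 m =
  ('C(partial_sum k.+1 m + k, k.+1) + monomial_rank k m)%N.
Proof. by []. Qed.

Lemma partial_sumD k m w :
  partial_sum k (fun i => m i + w i)%N = (partial_sum k m + partial_sum k w)%N.
Proof. by elim: k => //= k ->; rewrite addnACA. Qed.

Lemma partial_sum_ext k m m' : (forall i, (i < k)%N -> m i = m' i) ->
  partial_sum k m = partial_sum k m'.
Proof. by elim: k => //= k IH e; rewrite e // IH // => i ik; apply/e/ltnW. Qed.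

Lemma monomial_rank_ext k m m' : (forall i, (i < k)%N -> m i = m' i) ->
  monomial_rank k m = monomial_rank k m'.
Proof.
elim: k => // k IH e; rewrite !monomial_rankS IH => [|i ik]; last exact/e/ltnW.
by rewrite (partial_sum_ext e).
Qed.

(** ['C(d + k, k)] counts the exponent vectors of length [k] and degree at most [d]. Pascal's rule
    separates those of degree below [d] from those of degree [d]. *)
Lemma monomial_rank_lt_bin k m : (monomial_rank k m < 'C(partial_sum k m + k, k))%N.
Proof.
elim: k => [|k IH]; first by [].
rewrite monomial_rankS addnS binS ltn_add2l; apply: leq_trans IH _.
by apply: leq_bin2l; rewrite leq_add2r leq_addr.
Qed.

Lemma monomial_rank_lt_sum k m m' : (partial_sum k.+1 m < partial_sum k.+1 m')%N ->
  (monomial_rank k.+1 m < monomial_rank k.+1 m')%N.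
Proof.
move=> lt; apply: leq_trans (monomial_rank_lt_bin _ _) _.
rewrite [leqRHS]monomial_rankS; apply: leq_trans (leq_addr _ _).
by apply: leq_bin2l; rewrite addnS -addSn leq_add2r.
Qed.

(** Adding [w] raises a given partial sum of both vectors by the same amount, so the comparison is
    unchanged: the order is compatible with multiplication of monomials. *)
Lemma monomial_rank_shift k m m' w : (monomial_rank k m < monomial_rank k m')%N ->
  (monomial_rank k (fun i => m i + w i) < monomial_rank k (fun i => m' i + w i))%N.
Proof.
elim: k => // k IH lt; case: (ltngtP (partial_sum k.+1 m) (partial_sum k.+1 m')) => e.
- by apply: monomial_rank_lt_sum; rewrite !partial_sumD ltn_add2r.
- by have := ltn_trans lt (monomial_rank_lt_sum e); rewrite ltnn.
move: lt; rewrite !monomial_rankS !partial_sumD e !ltn_add2l; exact: IH.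
Qed.

Lemma monomial_rank_inj k m m' : monomial_rank k m = monomial_rank k m' ->
  forall i, (i < k)%N -> m i = m' i.
Proof.
elim: k => // k IH eqr.
have e : partial_sum k.+1 m = partial_sum k.+1 m'.
  by case: (ltngtP (partial_sum k.+1 m) (partial_sum k.+1 m')) => // /monomial_rank_lt_sum;
    rewrite eqr ltnn.
have {}IH : forall i, (i < k)%N -> m i = m' i.
  by apply: IH; move: eqr; rewrite !monomial_rankS e => /addnI.
move=> i; rewrite ltnS leq_eqVlt => /orP[/eqP->|/IH//].
by move: e => /=; rewrite (partial_sum_ext IH) => /addnI.
Qed.

(** By induction on [k]: a list [s] for the first [k] entries serves all vectors whose entry [k] is
    at least its maximum [N] over [s]. Each of the finitely many smaller values of that entry gets a
    list of its own. *)
Lemma dickson (k : nat) (T : eqType) (v : T -> nat -> nat) (E : T -> Prop) :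
  exists s : seq T, (forall t, t \in s -> E t) /\
    forall t, E t -> exists2 u, u \in s & forall i, (i < k)%N -> (v u i <= v t i)%N.
Proof.
elim: k E => [|k IH] E.
  have [[t Et]|none] := EM (exists t, E t); last first.
    by exists [::]; split=> // t Et; case: none; exists t.
  by exists [:: t]; split=> [u|u _]; [rewrite inE => /eqP-> | exists t; rewrite ?inE].
have [s [sE sP]] := IH E.
have /choice[S SP] j := IH (fun t => E t /\ v t k = j).
pose N := \max_(t <- s) v t k.
exists (s ++ flatten [seq S j | j <- iota 0 N]); split.
  move=> t; rewrite mem_cat => /orP[/sE//|/flatten_mapP[j _ /(SP j).1[]//]].
move=> t Et; have [lt|ge] := ltnP (v t k) N.
  have [u us uP] := (SP (v t k)).2 t (conj Et erefl).
  exists u; first by rewrite mem_cat; apply/orP; right; apply/flatten_mapP;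
    exists (v t k); rewrite // mem_iota add0n lt.
  move=> i; rewrite ltnS leq_eqVlt => /orP[/eqP->|]; last exact: uP.
  by have [_ ->] := (SP (v t k)).1 u us.
have [u us uP] := sP t Et; exists u; first by rewrite mem_cat us.
move=> i; rewrite ltnS leq_eqVlt => /orP[/eqP->|]; last exact: uP.
by apply: leq_trans ge; exact: (leq_bigmax_seq u us isT).
Qed.

(** * Leading terms of relations between monomials *)

Section Monomials.
Variables (R S : comPzRingType) (phi : {rmorphism R -> S}) (F : lmodType S).
Variables (n : nat) (g : 'I_n -> S) (s : seq F).

Let FR : lmodType R := restr phi F.

(* Entry [0] of an exponent vector selects the module generator. *)
Definition monomial_coef (m : nat -> nat) : S := \prod_(i < n) g i ^+ m i.+1.
Definition monomial (m : nat -> nat) : F := monomial_coef m *: s`_(m 0%N).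

Local Notation rank := (monomial_rank n.+1).

Lemma rank_vector_exists k : exists m, (exists m', rank m' = k) -> rank m = k.
Proof. by have [[m mk]|] := EM (exists m', rank m' = k); [exists m | exists id]. Qed.

Definition rank_vector (k : nat) : nat -> nat := projT1 (cid (rank_vector_exists k)).

Definition ranked (k : nat) : bool := rank (rank_vector k) == k.

Lemma rank_vectorK m : rank (rank_vector (rank m)) = rank m.
Proof. by rewrite /rank_vector; case: cid => m' /=; apply; exists m. Qed.

Lemma ranked_rank m : ranked (rank m). Proof. by apply/eqP; exact: rank_vectorK. Qed.

(** An index that is not a rank gives 0, so that the basis can be indexed by all of [nat]. A
    selector beyond the end of [s] also gives 0, by the default of [nth]. *)
Definition ranked_monomial (k : nat) : FR := if ranked k then monomial (rank_vector k) else 0.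

Lemma monomial_ext m m' : (forall i, (i < n.+1)%N -> m i = m' i) -> monomial m = monomial m'.
Proof.
move=> e; rewrite /monomial /monomial_coef e //; congr (_ *: _).
by apply: eq_bigr => i _; rewrite e // ltnS.
Qed.

Lemma ranked_monomialE m : ranked_monomial (rank m) = monomial m.
Proof.
by rewrite /ranked_monomial ranked_rank; apply/monomial_ext/monomial_rank_inj/rank_vectorK.
Qed.

Lemma monomialD m w : w 0%N = 0%N ->
  monomial (fun i => m i + w i)%N = monomial_coef w *: monomial m.
Proof.
move=> w0; rewrite /monomial w0 addn0 scalerA /monomial_coef -big_split /=.
by congr (_ *: _); apply: eq_bigr => i _; rewrite addnC exprD.
Qed.

Variables (L0 : lmodType R) (coef : L0 -> nat -> R) (b : nat -> L0).
Hypothesis bL0 : is_basis coef b.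
Variable pi : {linear L0 -> FR}.
Hypothesis piE : forall k, pi (b k) = ranked_monomial k.

Lemma monomials_generate :
  (forall x : S, exists t : seq (R * {ffun 'I_n -> nat}),
     x = \sum_(u <- t) phi u.1 * \prod_(i < n) g i ^+ u.2 i) ->
  (forall x : F, exists c : 'I_(size s) -> S, x = \sum_(i < size s) c i *: s`_i) ->
  forall y, exists x, pi x = y.
Proof.
move=> genS genF y; have [c ->] := genF y.
pose range (z : FR) := exists x, pi x = z.
have s_range : is_submodule range.
  split; first by exists 0; rewrite linear0.
  by move=> a _ _ [x <-] [x' <-]; exists (a *: x + x'); rewrite linearP.
apply: (submod_sum s_range) => j _; have [t ->] := genS (c j).
rewrite scaler_suml; apply: (submod_sum s_range) => -[a v] _ /=.
rewrite -scalerA; apply: (submodZ s_range a).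
pose m i := if i is i'.+1 then (if insub i' is Some k then v k else 0%N) else val j.
exists (b (rank m)); rewrite piE ranked_monomialE.
change (monomial_coef m *: s`_j = (\prod_(i < n) g i ^+ v i) *: s`_j).
by congr (_ *: _); apply: eq_bigr => i _; rewrite /= valK.
Qed.

(** Multiplication by a monomial of [S], lifted to [L0]; [w 0 = 0] keeps the module generator. As
    the order is compatible with it, leading terms go to leading terms with the same coefficient. *)
Lemma monomial_shift (w : nat -> nat) : w 0%N = 0%N ->
  exists shift : {linear L0 -> L0},
  [/\ forall x, pi x = 0 -> pi (shift x) = 0,
      forall x m, coef (shift x) (rank (fun i => m i + w i)%N) = coef x (rank m)
    & forall (I : R -> Prop), is_ideal I -> forall x m,
        (forall i, (rank m < i)%N -> I (coef x i)) ->
        forall i, (rank (fun i => m i + w i)%N < i)%N -> I (coef (shift x) i)].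
Proof.
move=> w0; have [_ _ _ ext] := bL0.
pose target k := rank (fun i => rank_vector k i + w i)%N.
have [sh shE] := ext L0 (fun k => if ranked k then b (target k) else 0).
exists sh.
have coefE x i : exists N, (forall k, (N <= k)%N -> coef x k = 0) /\
    coef (sh x) i = \sum_(k < N) if ranked k && (target k == i) then coef x k else 0.
  have [N xN] := coef_bounded bL0 x; exists N; split=> //.
  rewrite {1}(basis_sum_below bL0 xN) linear_sum (basis_coef_sum bL0).
  apply: eq_bigr => k _; rewrite linearZ_LR (basis_coefZ bL0) shE.
  case: ranked => /=; last first.
    by rewrite -(scale0r (0 : L0)) (basis_coefZ bL0) mul0r mulr0.
  by rewrite (coef_basis bL0); case: eqP => _; rewrite ?mulr1 ?mulr0.
split.
- have [h hE] : exists h : {linear L0 -> FR}, forall x, h x = monomial_coef w *: (pi x : F).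
    have [|h hE] := @is_linear_bundle R L0 FR (fun x => monomial_coef w *: (pi x : F)).
      move=> a x y; rewrite linearP; change (monomial_coef w *: (phi a *: (pi x : F) + pi y) =
        phi a *: (monomial_coef w *: (pi x : F)) + monomial_coef w *: (pi y : F)).
      by rewrite scalerDr !scalerA mulrC.
    by exists h.
  move=> x x0; have -> : pi (sh x) = h x; last by rewrite hE x0 scaler0.
  apply: (basis_eq bL0 (f := pi \o sh)) => k /=; rewrite shE hE piE /ranked_monomial.
  case: ifP => rk; last by rewrite linear0 scaler0.
  by rewrite piE ranked_monomialE monomialD.
- move=> x m; have [N [xN ->]] := coefE x (rank (fun i => m i + w i)%N).
  have tgt k : ranked k && (target k == rank (fun i => m i + w i)%N) = (k == rank m).
    apply/andP/eqP => [[/eqP rk /eqP/monomial_rank_inj e]|->].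
      rewrite -rk; apply: monomial_rank_ext => i /e /eqP.
      by rewrite eqn_add2r => /eqP.
    split; first exact: ranked_rank.
    apply/eqP; apply: monomial_rank_ext => i lt; congr (_ + _)%N.
    exact: (monomial_rank_inj (rank_vectorK m)).
  under eq_bigr => k _ do rewrite tgt.
  case: (ltnP (rank m) N) => rN.
    rewrite (bigD1 (Ordinal rN)) //= eqxx big1 ?addr0 // => k.
    by rewrite -val_eqE /= => /negPf ->.
  rewrite xN // big1 // => k _; case: eqP => // ke.
  by have := ltn_ord k; rewrite ke ltnNge rN.
move=> I idI x m Ix i lt; have [N [xN ->]] := coefE x i.
have sI := ideal_submodule idI; apply: (submod_sum sI) => k _.
case: ifP => [/andP[/eqP rk /eqP ti]|_]; last exact: (submod0 sI).
apply: Ix; rewrite ltnNge; apply/negP; rewrite -rk leq_eqVlt => /orP[/eqP e|].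
  move: lt; rewrite -ti /target (monomial_rank_ext (m' := fun i => m i + w i)%N) ?ltnn //.
  by move=> j /(monomial_rank_inj e) ->.
by move=> /(@monomial_rank_shift _ _ _ w) /ltn_trans/(_ lt); rewrite -ti ltnn.
Qed.

(* By Dickson's lemma the leading relations modulo a prime [I] are multiples of
   finitely many, and [a] is the product of their leading coefficients. *)
Lemma generic_leading (I : R -> Prop) : is_ideal I -> ~ I 1 ->
  (forall a c, I (a * c) -> I a \/ I c) ->
  exists2 a, ~ I a & forall k x, leads_at coef (fun x => pi x = 0) I k x ->
    ~ I (coef x k) -> exists y, leads_at coef (fun x => pi x = 0) I k y /\
      exists d, coef y k * d = a.
Proof.
move=> idI nI1 prI; have sI := ideal_submodule idI.
pose leads := leads_at coef (fun x => pi x = 0) I.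
pose E (m : nat -> nat) := (m 0 < size s)%N /\ exists2 x, leads (rank m) x & ~ I (coef x (rank m)).
(* Divisibility of monomials requires equal module generators. The extra entry [size s - m 0]
   reverses the comparison of entry 0 and so forces equality. *)
have [ms [msE msP]] := @dickson n.+2 (nat -> nat)
  (fun m i => if i == n.+1 then (size s - m 0%N)%N else m i) E.
have /choice[rel relP] m : exists x, E m -> leads (rank m) x /\ ~ I (coef x (rank m)).
  by have [[_ [x lx nIx]]|] := EM (E m); [exists x | exists 0].
exists (\prod_(m <- ms) coef (rel m) (rank m)).
  elim: ms msE {msP} => [|m ms IH] msE; first by rewrite big_nil.
  rewrite big_cons => /prI[]; last by apply: IH => m' m'ms; apply: msE; rewrite inE m'ms orbT.
  by case: (relP m); first by apply: msE; rewrite inE eqxx.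
move=> k x lx nIx.
(* If the monomial of index [k] is 0, then [b k] is itself a relation, with leading coefficient
   1. *)
have [ek|ek] := eqVneq (ranked_monomial k) 0.
  exists (b k); split; last by rewrite (coef_basis bL0) eqxx; eexists; exact: mul1r.
  split; first by rewrite piE ek.
  move=> i; rewrite (coef_basis bL0) => /ltn_eqF ->; exact: (submod0 sI).
have rk : ranked k by apply: contraNT ek => /negPf rk; rewrite /ranked_monomial rk.
set m := rank_vector k; have mk : rank m = k by apply/eqP.
have m0 : (m 0 < size s)%N.
  rewrite ltnNge; apply: contraNN ek => le; rewrite /ranked_monomial rk /monomial.
  by rewrite nth_default // scaler0.
have [u ums uP] : exists2 u, u \in ms & forall i, (i < n.+2)%N ->
    ((if i == n.+1 then size s - u 0 else u i) <= (if i == n.+1 then size s - m 0 else m i))%N.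
  by apply: msP; split=> //; exists x; rewrite mk.
have [u0 [y0 _ _]] := msE u ums.
have [[Oy yI] nIy] := relP u (msE u ums).
have um i : (i < n.+1)%N -> (u i <= m i)%N.
  by move=> lt; have := uP i (ltnW lt); rewrite (ltn_eqF lt).
have u0m : u 0%N = m 0%N.
  by have := uP n.+1 (ltnSn _); have := um 0%N isT; rewrite eqxx; lia.
pose w i := (m i - u i)%N.
have [|sh [sh0 shc shI]] := @monomial_shift w; first by rewrite /w u0m subnn.
have wk : rank (fun i => u i + w i)%N = k.
  by rewrite -mk; apply: monomial_rank_ext => i /um; rewrite /w; lia.
exists (sh (rel u)); split.
  split; first exact: sh0.
  by move=> i; rewrite -wk; exact: shI.
rewrite -wk shc (big_rem u) //=; by eexists.
Qed.

End Monomials.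

(** * Splitting of extensions and conclusion *)

(** Lift [pi] to [q : L0 -> E]. On the kernel of [pi] it takes values in [C]; subtracting an
    extension of this restriction to [L0] leaves a map that factors through [F] and splits [p]. *)
Lemma extendable_ext1_zero (R : comPzRingType) (F C L0 : lmodType R)
    (coef : L0 -> nat -> R) (b : nat -> L0) (pi : {linear L0 -> F}) :
  is_basis coef b -> (forall y, exists x, pi x = y) ->
  extendable (fun x => pi x = 0) C -> ext1_zero F C.
Proof.
move=> bL0 pi_surj extC E i p i_inj p_surj p_exact.
have [q qE] := basis_lift bL0 pi p_surj.
have /choice[f fE] x : exists c, pi x = 0 -> q x = i c.
  have [x0|] := EM (pi x = 0); last by exists 0.
  by have [|c ->] := (p_exact (q x)).1; [rewrite qE | exists c].
have [|g gE] := extC f.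
  move=> a x y x0 y0; apply: i_inj; rewrite -fE; last first.
    by rewrite linearP x0 y0 scaler0 addr0.
  by rewrite !linearP !fE.
have [|h hE] := @is_linear_bundle R L0 E (fun x => q x - i (g x)).
  by move=> a x y; rewrite !linearP scalerDr addrACA.
have [|s sE] := factor_through_surjection (p := pi) (f := h) pi_surj.
  by move=> x x0; rewrite hE gE // -fE // subrr.
exists s => y; have [x <-] := pi_surj y.
rewrite sE hE linearB qE.
have -> : p (i (g x)) = 0 by apply/p_exact; exists (g x).
by rewrite subr0.
Qed.

Theorem theorem1p3 (R : comPzRingType) (S : comPzRingType)
  (phi : {rmorphism R -> S}) (F : lmodType S) :
  noetherian R -> fin_gen_algebra phi -> fin_gen_module F ->
  flat (restr phi F) -> very_flat (restr phi F).
Proof.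
move=> noethR [n [g genS]] [s genF] flatF C hC.
have [L0 [coef [b bL0]]] := free_module R nat.
have [_ _ _ ext] := bL0.
have [pi piE] := ext (restr phi F : lmodType R) (ranked_monomial phi g s).
have pi_surj := monomials_generate piE genS genF.
have splitOm := flat_locally_split noethR bL0 pi_surj flatF.
have sOm : is_submodule (fun x => pi x = 0).
  by split=> [|a x y x0 y0]; rewrite ?linear0 // linearP x0 y0 scaler0 addr0.
apply: (extendable_ext1_zero bL0 pi_surj).
apply: (extendable_contraadjusted noethR bL0 sOm splitOm) => [I idI nI1 prI|]; last first.
  exact: contraadjusted_solves_telescopes.
have [a nIa lead] := generic_leading bL0 piE idI nI1 prI.
by exists a => // G; exact: (extendable_leading bL0 sOm splitOm idI lead).
Qed.
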